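(* Let $n\ge 1$ be an integer, let $p_1,\dots,p_{n+3}$ be distinct points of $\mathbb{P}^n$ whose linear span is the whole space $\mathbb{P}^n$, let $m_1,\dots,m_{n+3}$ be positive integers, and let $Z:=\sum_{i=1}^{n+3} m_ip_i$. Then $$\operatorname{reg}(Z)\le \max\{T(Z,L)\;:\; L\subseteq \mathbb{P}^n \text{ a linear subspace with } 1\le \dim L\le n\},$$ where, for a linear subspace $L$ of dimension $r$, $T(Z,L):=\left\lfloor\frac{\mathrm{w}_L(Z)+r-2}{r}\right\rfloor$.
   Context: $K$ is an algebraically closed field, $\mathbb{P}^n=\mathbb{P}^n_K$ and $R=K[x_0,\dots,x_n]$. For distinct points $p_1,\dots,p_s\in\mathbb{P}^n$ with homogeneous prime ideals $\mathfrak{p}_1,\dots,\mathfrak{p}_s\subset R$ and positive integers $m_1,\dots,m_s$, $\sum_{i=1}^s m_ip_i$ denotes the $0$-dimensional subscheme $Z$ of $\mathbb{P}^n$ (scheme of fat points) defined by the saturated ideal $\mathfrak{p}_1^{m_1}\cap\cdots\cap\mathfrak{p}_s^{m_s}$; $\mathcal{I}_Z$ denotes its ideal (sheaf). The regularity index $\operatorname{reg}(Z)$ is the smallest positive integer $d$ such that $h^1(\mathbb{P}^n,\mathcal{I}_Z(d))=0$. For a subset $L\subseteq\mathbb{P}^n$, $\mathrm{w}_L(Z):=\sum_{i:\,p_i\in L} m_i$. *)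

(* Defs.v *)
From HB Require Import structures.
From mathcomp Require Import all_boot all_order all_algebra.
From mathcomp Require Import mpoly.

Set Implicit Arguments.
Unset Strict Implicit.
Unset Printing Implicit Defensive.

Import Order.TTheory GRing.Theory Num.Theory.

Local Open Scope ring_scope.

(* Points of P^n are the lines through 0 in K^(n+1), and a linear subspace of
   P^n of dimension r is a vector subspace of K^(n+1) of dimension r + 1. *)
Definition proj_point (K : fieldType) (n : nat) : Type :=
  {P : {vspace 'rV[K]_n.+1} | \dim P == 1%N}.

Definition lies_on (K : fieldType) (n : nat)
    (P : proj_point K n) (L : {vspace 'rV[K]_n.+1}) : bool :=
  (val P <= L)%VS.

Definition spans_space (K : fieldType) (n s : nat)
    (p : 'I_s -> proj_point K n) : Prop :=
  (\sum_(i < s) val (p i))%VS = fullv.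

(* The empty subspace gets dimension 0 instead of -1; it is only used under
   the condition 1 <= proj_dim L. *)
Definition proj_dim (K : fieldType) (n : nat)
    (L : {vspace 'rV[K]_n.+1}) : nat :=
  (\dim L).-1.

(* Vanishing at all homogeneous coordinates of P. Over an infinite field this
   is the ideal generated by the forms vanishing at P. *)
Definition point_ideal (K : fieldType) (n : nat) (P : proj_point K n)
    (f : {mpoly K[n.+1]}) : Prop :=
  forall v : 'rV[K]_n.+1, v \in val P -> v != 0 -> f.@[fun i => v ord0 i] = 0.

Definition ideal_pow (A : comNzRingType) (I : A -> Prop) (m : nat)
    (f : A) : Prop :=
  exists (t : nat) (a : 'I_t -> A) (g : 'I_t -> 'I_m -> A),
    (forall j k, I (g j k)) /\ f = \sum_(j < t) a j * \prod_(k < m) g j k.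

Definition fat_ideal (K : fieldType) (n s : nat)
    (p : 'I_s -> proj_point K n) (m : 'I_s -> nat)
    (f : {mpoly K[n.+1]}) : Prop :=
  forall i : 'I_s, ideal_pow (point_ideal (p i)) (m i) f.

(* For a homogeneous ideal I with associated sheaf I~ on P^n, the sections of
   I~(d) over the open set x^a <> 0 are the elements of degree d of the
   localization of I at x^a. All these localizations are seen inside the
   fraction field of the polynomial ring, where restriction is inclusion. *)
Definition sheaf_section (K : fieldType) (n : nat)
    (I : {mpoly K[n.+1]} -> Prop) (d : nat) (a : 'X_{1..n.+1})
    (g : {fraction {mpoly K[n.+1]}}) : Prop :=
  exists (k : nat) (f : {mpoly K[n.+1]}),
    [/\ I f, f \is (d + k * mdeg a)%N.-homog
      & g = tofrac f / tofrac 'X_[a] ^+ k].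

(* Cech cochains for the affine cover of P^n by the open sets x_i <> 0. *)
Definition cech_cochain0 (K : fieldType) (n : nat)
    (I : {mpoly K[n.+1]} -> Prop) (d : nat)
    (h : 'I_n.+1 -> {fraction {mpoly K[n.+1]}}) : Prop :=
  forall i, sheaf_section I d U_(i)%MM (h i).

Definition cech_cocycle1 (K : fieldType) (n : nat)
    (I : {mpoly K[n.+1]} -> Prop) (d : nat)
    (g : 'I_n.+1 -> 'I_n.+1 -> {fraction {mpoly K[n.+1]}}) : Prop :=
  (forall i j, sheaf_section I d (U_(i) + U_(j))%MM (g i j)) /\
  (forall i j k, g j k - g i k + g i j = 0).

(* h^1(P^n, I~(d)) = 0. The cohomology of the quasi-coherent sheaf I~(d) is
   its Cech cohomology for the standard affine cover. *)
Definition h1_vanishes (K : fieldType) (n : nat)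
    (I : {mpoly K[n.+1]} -> Prop) (d : nat) : Prop :=
  forall g, cech_cocycle1 I d g ->
    exists2 h, cech_cochain0 I d h & forall i j, g i j = h j - h i.

Definition is_reg_index (K : fieldType) (n : nat)
    (I : {mpoly K[n.+1]} -> Prop) (d : nat) : Prop :=
  [/\ (0 < d)%N, h1_vanishes I d
    & forall e : nat, (0 < e)%N -> h1_vanishes I e -> (d <= e)%N].

Definition weight (K : fieldType) (n s : nat)
    (p : 'I_s -> proj_point K n) (m : 'I_s -> nat)
    (L : {vspace 'rV[K]_n.+1}) : nat :=
  (\sum_(i < s | lies_on (p i) L) m i)%N.

(* The quotient is taken in int because the numerator is -1 when L is a line
   containing none of the points. *)
Definition segre_T (K : fieldType) (n s : nat)
    (p : 'I_s -> proj_point K n) (m : 'I_s -> nat)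
    (L : {vspace 'rV[K]_n.+1}) : int :=
  (((weight p m L)%:Z + (proj_dim L)%:Z - 2) %/ (proj_dim L)%:Z)%Z.

Definition is_max_of (S : int -> Prop) (M : int) : Prop :=
  S M /\ forall t, S t -> t <= M.

(* Main.v *)
Require Import Defs.
From HB Require Import structures.
From mathcomp Require Import all_boot all_order all_algebra.
From mathcomp Require Import mpoly.
From mathcomp Require Import zify ring.
From Stdlib Require Import Classical.

Set Implicit Arguments.
Unset Strict Implicit.
Unset Printing Implicit Defensive.

Import Order.TTheory GRing.Theory Num.Theory.

(* Let d be at least every T(Z, L). Since H^1(O(d)) = 0, it suffices to find a
   form of degree d with prescribed expansion up to order m_i at each p_i. This
   goes by induction on the sum of the m_i, lowering the multiplicity mu + 1 of
   a point p of minimal multiplicity: every form of degree mu in the directions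
   at p must be the leading form at p of some form of degree d that vanishes to
   order m_i at the other p_i. Take coordinate forms y_k vanishing at p and dual
   to all the other points except at most two, and multiply each monomial y^c of
   degree mu by d - mu linear forms that do not vanish at p. At p_i these must
   supply the order of vanishing that y^c lacks. By Rado's theorem for the
   projections of the points from p, this is possible as soon as, for every set
   A of points, the total order still needed on A is at most d - mu times the
   rank of A. The points have nullity at most 2, so that only the circuits
   through both omitted points are not immediate; if these two points are taken
   in the complements of two smallest circuits, the inequality follows from the
   Segre bounds. *)

(** * Matroids *)

Record matroid_rank (I : finType) (r : {set I} -> nat) : Prop := MatroidRank {
  rank0 : r set0 = 0;
  rankS : forall A B : {set I}, A \subset B -> r A <= r B;
  rankU1 : forall x (A : {set I}), r (x |: A) <= (r A).+1;
  rank_submod : forall A B : {set I}, r (A :|: B) + r (A :&: B) <= r A + r B }.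

(* As long as some member of the family has two elements, one of them can be
   removed without destroying the rank condition. *)
Lemma rado_transversal (T X : finType) (r : {set X} -> nat) :
    r set0 = 0 ->
    (forall A B : {set X}, A \subset B -> r A <= r B) ->
    (forall A B : {set X}, r (A :|: B) + r (A :&: B) <= r A + r B) ->
  forall A : T -> {set X},
    (forall J : {set T}, #|J| <= r (\bigcup_(t in J) A t)) ->
  exists2 f : T -> X, forall t, f t \in A t
    & forall J : {set T}, #|J| <= r (f @: J).
Proof.
move=> r0 rS rM A.
have [k] := ubnP (\sum_t #|A t|); elim: k A => // k IHk A leAk HA.
have [/existsP[t ltA]|] := boolP [exists t, 1 < #|A t|]; last first.
  rewrite negb_exists => /forallP A1.
  have /fin_all_exists[f fP] t : exists x, A t = [set x].
    apply/cards1P; rewrite eqn_leq leqNgt A1 /= card_gt0.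
    apply: contraTneq (HA [set t]) => At0.
    by rewrite big_set1 At0 r0 cards1.
  exists f => [t|J]; first by rewrite fP set11.
  apply: leq_trans (HA J) (rS _ _ _).
  apply/bigcupsP => u uJ; rewrite fP sub1set.
  exact: imset_f.
have [x xA [y yA xy]] : exists2 x, x \in A t & exists2 y, y \in A t & x != y.
  by have /card_gt1P[x [y [xA yA xy]]] := ltA; exists x => //; exists y.
pose Az z u := if u == t then A t :\ z else A u.
have [|] := boolP [exists z in [set x; y], [forall J : {set T},
    #|J| <= r (\bigcup_(u in J) Az z u)]].
  case/exists_inP => z zxy /forallP HAz.
  have zA : z \in A t by move: zxy; rewrite !inE => /orP[]/eqP->.
  have [|f fA fr] := IHk (Az z) _ HAz.
    rewrite -ltnS; apply: leq_trans leAk; rewrite ltnS.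
    rewrite (bigD1 t) //= [X in _ < X](bigD1 t) //=.
    rewrite /Az eqxx -addSn (cardsD1 z (A t)) zA add1n leq_add2l.
    by apply/eq_leq/eq_bigr => u /negPf->.
  exists f => // u; move: (fA u); rewrite /Az; case: eqP => // ->.
  by rewrite !inE => /andP[].
rewrite negb_exists_in => /forall_inP H.
have bad z : z \in [set x; y] -> exists J : {set T},
    [/\ t \in J & r (\bigcup_(u in J :\ t) A u :|: (A t :\ z)) < #|J|].
  move/H; rewrite negb_forall => /existsP[J]; rewrite -ltnNge => ltJ.
  have tJ : t \in J.
    apply: contraLR ltJ => tJ; rewrite -leqNgt; apply: leq_trans (HA J) (rS _ _ _).
    apply/bigcupsP => u uJ; apply: (bigcup_max u) => //.
    by rewrite /Az; case: eqP => // ut; rewrite -ut uJ in tJ.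
  exists J; split=> //; apply: leq_ltn_trans ltJ; apply: rS.
  rewrite subUset; apply/andP; split.
    apply/bigcupsP => u; rewrite !inE => /andP[ut uJ].
    by apply: (bigcup_max u) => //; rewrite /Az (negPf ut).
  by apply: (bigcup_max t) => //; rewrite /Az eqxx.
(* Neither [x] nor [y] can be removed. The violating sets [J] and [J'] share [t], so submodularity
   for [Y] and [Y'] gives the contradiction [#|J| + #|J'| - 1 <= r Y + r Y' <= #|J| + #|J'| - 2]. *)
have [|J [tJ ltJ]] := bad x; first by rewrite !inE eqxx.
have [|J' [tJ' ltJ']] := bad y; first by rewrite !inE eqxx orbT.
set Y := (_ :|: _) in ltJ; set Y' := (_ :|: _) in ltJ'.
have leU : #|J :|: J'| <= r (Y :|: Y').
  apply: leq_trans (HA _) (rS _ _ _); apply/bigcupsP => u uJJ.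
  have [->|ut] := eqVneq u t.
    apply/subsetP => z zA; rewrite !inE zA.
    by have [->|_] := eqVneq z x; rewrite ?xy !(orbT, andbT).
  apply/subsetP => z zA; move: uJJ; rewrite !inE => /orP[uJ|uJ'].
    by apply/orP; left; apply/orP; left; apply/bigcupP; exists u; rewrite ?inE ?ut.
  by apply/orP; right; apply/orP; left; apply/bigcupP; exists u; rewrite ?inE ?ut.
have leI : #|(J :&: J') :\ t| <= r (Y :&: Y').
  apply: leq_trans (HA _) (rS _ _ _); apply/bigcupsP => u.
  rewrite !inE => /and3P[ut uJ uJ']; apply/subsetP => z zA; rewrite !inE.
  by apply/andP; split; apply/orP; left; apply/bigcupP; exists u; rewrite ?inE ?ut.
have := cardsUI J J'; have := rM Y Y'.
have tI : t \in J :&: J' by rewrite inE tJ tJ'.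
rewrite (cardsD1 t (J :&: J')) tI; lia.
Qed.

(** * Rank, circuits and nullity *)

Section Matroid.
Variables (I : finType) (r : {set I} -> nat).
Hypothesis rP : matroid_rank r.
Implicit Types (A B S E : {set I}) (x y : I).

Lemma rank_le_setD A B : r B <= r A + #|B :\: A|.
Proof.
have [k] := ubnP #|B :\: A|; elim: k B => // k IHk B leBk.
have [/eqP|/set0Pn[x xD]] := eqVneq (B :\: A) set0.
  by rewrite setD_eq0 => /(rankS rP)/leq_trans; apply; rewrite leq_addr.
have xB : x \in B by move: xD; rewrite inE => /andP[].
have eqD : (B :\ x) :\: A = (B :\: A) :\ x.
  by apply/setP => z; rewrite !inE andbCA.
have := cardsD1 x (B :\: A); rewrite xD -eqD => cD.
have le1 : r (B :\ x) <= r A + #|B :\ x :\: A| by apply: IHk; lia.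
by have := rankU1 rP x (B :\ x); rewrite setD1K //; lia.
Qed.

Lemma rank_le_card A : r A <= #|A|.
Proof. by have := rank_le_setD set0 A; rewrite (rank0 rP) setD0. Qed.

Lemma dependentS A B : A \subset B -> r A < #|A| -> r B < #|B|.
Proof.
move=> AB rA; have := rank_le_setD A B; rewrite (cardsDS AB).
have := subset_leq_card AB; lia.
Qed.

Lemma independentS A B : A \subset B -> r B = #|B| -> r A = #|A|.
Proof.
move=> AB rB; apply/eqP; rewrite eqn_leq rank_le_card leqNgt.
by apply/negP => /(dependentS AB); rewrite rB ltnn.
Qed.

Lemma closureS x A B : A \subset B -> r (x |: A) = r A -> r (x |: B) = r B.
Proof.
move=> AB rA; apply/eqP; rewrite eqn_leq [r B <= _](rankS rP) ?subsetUr // andbT.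
have := rank_submod rP (x |: A) B.
rewrite -setUA (setUidPr AB) => H.
have : r A <= r ((x |: A) :&: B) by apply: (rankS rP); rewrite subsetI subsetUr.
lia.
Qed.

Lemma closureD1 x A B : x \in A -> x \in B -> A \subset B ->
  r (A :\ x) = r A -> r (B :\ x) = r B.
Proof.
move=> xA xB AB rA; rewrite -{2}(setD1K xB); apply/esym.
by apply: (@closureS x (A :\ x)); rewrite ?setSD ?setD1K.
Qed.

Lemma rank_le_spanned A B : A \subset B ->
  (forall x, x \in B -> r (x |: A) = r A) -> r B = r A.
Proof.
have [k] := ubnP #|B :\: A|; elim: k B => // k IHk B leBk AB Bcl.
have [/eqP|/set0Pn[x xD]] := eqVneq (B :\: A) set0.
  by rewrite setD_eq0 => BA; congr r; apply/eqP; rewrite eqEsubset AB BA.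
have [xB xA] : x \in B /\ x \notin A by move: xD; rewrite inE => /andP[].
have eqD : (B :\ x) :\: A = (B :\: A) :\ x.
  by apply/setP => z; rewrite !inE andbCA.
have AB' : A \subset B :\ x by rewrite subsetD1 AB xA.
rewrite -(setD1K xB) (closureS AB' (Bcl x xB)) IHk // => [|y].
  by have := cardsD1 x (B :\: A); rewrite xD -eqD; lia.
by rewrite inE => /andP[_ /Bcl].
Qed.

(** Deleting [x] keeps the rank of [E], since [A :\ x] spans [x], and leaves the dependent set [B]:
    the nullity drops by one and is still positive. The lemma refutes such configurations in sets of
    nullity at most 1. *)
Lemma nullity2 x A B E : A \subset E -> B \subset E -> x \in A -> x \notin B ->
  r (A :\ x) = r A -> r B < #|B| -> r E + 2 <= #|E|.
Proof.
move=> AE BE xA xB rA rB; have xE := subsetP AE x xA.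
have /dependentS/(_ rB) : B \subset E :\ x by rewrite subsetD1 BE.
rewrite (closureD1 xA xE AE rA); have := cardsD1 x E; rewrite xE; lia.
Qed.

Lemma minimal_dependentD1 x A : r A < #|A| -> r (A :\ x) = #|A :\ x| ->
  r (A :\ x) = r A.
Proof.
move=> rA rAx; have := rankS rP (subsetDl A [set x]).
by have := cardsD1 x A; case: (x \in A); lia.
Qed.

Lemma exists_basis E : exists B, [/\ B \subset E, r B = #|B| & r B = r E].
Proof.
pose P B := (B \subset E) && (r B == #|B|).
have P0 : P set0 by rewrite /P sub0set (rank0 rP) cards0.
case: (@arg_maxnP _ set0 P (fun B => #|B|) P0) => B /andP[BE /eqP rB] Bmax.
exists B; split=> //; apply/esym/rank_le_spanned => // x xE.
apply/eqP; rewrite eqn_leq [r B <= _](rankS rP) ?subsetUr // andbT leqNgt.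
apply/negP => lt; have xB : x \notin B.
  by apply: contraTN lt => xB; rewrite (setUidPr _) ?ltnn ?sub1set.
have /Bmax : P (x |: B).
  rewrite /P subUset sub1set xE BE /=.
  by have := rank_le_card (x |: B); rewrite cardsU1 xB; lia.
by rewrite cardsU1 xB /=; lia.
Qed.

(** In nullity 2, let [C1] be a smallest circuit and [C2] a smallest one among the others; [Q]
    consists of a point of [C2 :\: C1] and a point of [C1 :\: C2]. A circuit [A] through both
    contains the symmetric difference of [C1] and [C2] and lies in their union, and the minimality
    of [C2] bounds its size from below. *)
Lemma basis_complement E : #|E| <= r E + 2 ->
  exists Q : {set I}, [/\ Q \subset E, #|Q| <= 2, r (E :\: Q) = #|E :\: Q|,
    r (E :\: Q) = r E &
  forall A, A \subset E -> Q \subset A -> #|Q| = 2 -> (r A).+1 = #|A| ->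
    (forall x, x \in A -> r (A :\ x) = r A) ->
  forall l, l \in A :\: Q ->
    (forall q, q \in Q -> r (q |: (E :\: Q) :\ l) != r ((E :\: Q) :\ l)) ->
  5 <= #|A| \/ exists2 x, x \in E :\: A & r (x |: A) = r A].
Proof.
move=> leE.
(* In nullity at most 1 the complement of any basis has at most one element, and the clause on
   [#|Q| = 2] is vacuous. *)
have [ltE|geE] := ltnP #|E| (r E + 2).
  have [B [BE rB rBE]] := exists_basis E.
  have eB : E :\: (E :\: B) = B by rewrite setDDr setDv set0U; apply/setIidPr.
  exists (E :\: B); rewrite eB subsetDl; have := cardsDS BE.
  by split=> //; lia.
pose P1 S := (S \subset E) && (r S < #|S|).
have P1E : P1 E by rewrite /P1 subxx; lia.
case: (@arg_minnP _ E P1 (fun S => #|S|) P1E) => C1 /andP[C1E rC1] C1min.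
have C1ind x : x \in C1 -> r (C1 :\ x) = #|C1 :\ x|.
  move=> xC; apply/eqP; rewrite eqn_leq rank_le_card leqNgt; apply/negP => lt.
  have /C1min : P1 (C1 :\ x) by rewrite /P1 lt (subset_trans (subsetDl _ _)).
  by rewrite (cardsD1 x C1) xC; lia.
have C1cl x xC := minimal_dependentD1 rC1 (C1ind x xC).
have /card_gt0P[i iC1] : 0 < #|C1| by lia.
(* A smallest member of P2 is a circuit C2 different from C1. *)
pose P2 S := P1 S && ~~ (C1 \subset S).
have P2E : P2 (E :\ i).
  rewrite /P2 /P1 subsetDl /=; apply/andP; split; last first.
    by apply/negP => /subsetP/(_ i iC1); rewrite !inE eqxx.
  have iE := subsetP C1E i iC1; have := cardsD1 i E.
  by rewrite (closureD1 iC1 iE C1E (C1cl i iC1)) iE; lia.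
case: (@arg_minnP _ _ P2 (fun S => #|S|) P2E) => C2 /andP[/andP[C2E rC2] C12] C2min.
have C2ind x : x \in C2 -> r (C2 :\ x) = #|C2 :\ x|.
  move=> xC; apply/eqP; rewrite eqn_leq rank_le_card leqNgt; apply/negP => lt.
  have /C2min : P2 (C2 :\ x).
    rewrite /P2 /P1 lt (subset_trans (subsetDl _ _)) //=.
    by apply: contra C12 => /subset_trans; apply; apply: subsetDl.
  by rewrite (cardsD1 x C2) xC; lia.
have C2cl x xC := minimal_dependentD1 rC2 (C2ind x xC).
have leC : #|C1| <= #|C2| by apply: C1min; rewrite /P1 C2E rC2.
have [q2 q2C1 q2C2] := subsetPn C12.
have C21 : ~~ (C2 \subset C1).
  apply: contra C12 => C21; have /eqP -> // : C2 == C1.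
  by rewrite eqEcard C21 leC.
have [q1 q1C2 q1C1] := subsetPn C21.
have q12 : q1 != q2 by apply: contraNneq q2C2 => <-.
have [q1E q2E] := (subsetP C2E _ q1C2, subsetP C1E _ q2C1).
have QE : [set q1; q2] \subset E by rewrite subUset !sub1set q1E.
have cQ : #|[set q1; q2]| = 2 by rewrite cards2 q12.
set B := E :\: [set q1; q2].
have cB : #|B| = #|E| - 2 by rewrite cardsDS // cQ.
have C1B : C1 :\ q2 \subset B.
  apply/subsetP => z; rewrite !inE negb_or => /andP[-> zC1].
  by rewrite (subsetP C1E) // !andbT; apply: contraNneq q1C1 => <-.
have C2B : C2 :\ q1 \subset B.
  apply/subsetP => z; rewrite !inE negb_or => /andP[-> zC2].
  by rewrite (subsetP C2E) // !andbT /=; apply: contraNneq q2C2 => <-.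
have q2B : r (q2 |: B) = r B.
  by apply: closureS C1B _; rewrite setD1K // C1cl.
have q1B : r (q1 |: B) = r B.
  by apply: closureS C2B _; rewrite setD1K // C2cl.
have rBE : r B = r E.
  apply/esym/rank_le_spanned; rewrite ?subsetDl // => x xE.
  have [->//|x1] := eqVneq x q1; have [->//|x2] := eqVneq x q2.
  by congr r; apply/setUidPr; rewrite sub1set !inE negb_or x1 x2.
exists [set q1; q2]; split=> //; first by rewrite cQ.
  by apply/eqP; rewrite -/B eqn_leq rank_le_card cB rBE leq_subLR addnC.
move=> A AE /subsetP QA _ rA Acl l; rewrite inE => /andP[lQ lA] lcl.
have [q1A q2A] : q1 \in A /\ q2 \in A by split; apply: QA; rewrite !inE eqxx ?orbT.
have depA : r A < #|A| by rewrite -rA.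
have C1A : ~~ (C1 \subset A).
  apply/negP => C1A; have := nullity2 (subxx _) C1A q1A q1C1 (Acl _ q1A) rC1.
  by rewrite -rA addn2 ltnn.
have leA : #|C2| <= #|A| by apply: C2min; rewrite /P2 /P1 AE depA.
(* Without the point [x] of a circuit, [E] has nullity at most 1, so it cannot contain both the
   circuit [A] through [y] and a dependent set [C'] that avoids [y]. *)
have out x y (C C' : {set I}) :
    x \in C -> x \notin A -> C \subset E -> C' \subset E ->
    r (C :\ x) = r C -> x \notin C' -> y \in A -> y \notin C' ->
    r C' < #|C'| -> False.
  move=> xC xA CE C'E Ccl xC' yA yC' rC'; have xE := subsetP CE x xC.
  have := @nullity2 y A C' (E :\ x); rewrite !subsetD1 AE C'E xA xC' yA yC'.
  move/(_ isT isT isT isT (Acl _ yA) rC').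
  rewrite (closureD1 xC xE CE Ccl); have := cardsD1 x E; rewrite xE.
  by clear -leE; lia.
have DA1 : C1 :\: C2 \subset A.
  apply/subsetP => j; rewrite inE => /andP[jC2 jC1]; apply: contraT => jA.
  by case: (out j q2 C1 C2) => //; apply: C1cl.
have DA2 : C2 :\: C1 \subset A.
  apply/subsetP => j; rewrite inE => /andP[jC1 jC2]; apply: contraT => jA.
  by case: (out j q1 C2 C1) => //; apply: C2cl.
(* The same argument with the roles exchanged: deleting a point [j] of [A] would leave both [C1] and
   [C2]. *)
have AC : A \subset C1 :|: C2.
  apply/subsetP => j jA; rewrite inE; apply: contraT.
  rewrite negb_or => /andP[j1 j2].
  have jE := subsetP AE j jA.
  have := @nullity2 q2 C1 C2 (E :\ j); rewrite !subsetD1 C1E C2E j1 j2.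
  move/(_ isT isT q2C1 q2C2 (C1cl _ q2C1) rC2).
  rewrite (closureD1 jA jE AE (Acl j jA)); have := cardsD1 j E; rewrite jE.
  by clear -leE; lia.
(* If [l] were outside [C1], then [C1 :\ q2] would lie in [B :\ l] and span [q2]; likewise for [C2]
   and [q1]. *)
have lC : l \in C1 :&: C2.
  rewrite inE; apply/andP; split.
    apply: contraT => lC1; have := lcl q2; rewrite !inE eqxx orbT => /(_ isT)/eqP[].
    apply: (@closureS _ (C1 :\ q2)); rewrite ?setD1K ?C1cl //.
    by rewrite subsetD1 C1B !inE negb_and lC1 orbT.
  apply: contraT => lC2; have := lcl q1; rewrite !inE eqxx => /(_ isT)/eqP[].
  apply: (@closureS _ (C2 :\ q1)); rewrite ?setD1K ?C2cl //.
  by rewrite subsetD1 C2B !inE negb_and lC2 orbT.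
set D := (C1 :|: C2) :\: A.
have cD : #|D| = #|C1 :|: C2| - #|A| by rewrite cardsDS.
have cI := subset_leq_card AC; have cUI := cardsUI C1 C2.
have c1 := cardsID C2 C1; have c2 := cardsID C1 C2; rewrite setIC in c2.
have cA : #|C1 :\: C2| + #|C2 :\: C1| + 1 <= #|A|.
  have <- : #|[set l]| = 1 by rewrite cards1.
  rewrite (_ : _ + _ = #|(C1 :\: C2) :|: (C2 :\: C1) :|: [set l]|); last first.
    rewrite !cardsU; set X := _ :&: [set l]; set Y := _ :&: (_ :\: _).
    have -> : X = set0.
      apply/setP => z; rewrite !inE; case: (z =P l) => [->|]; rewrite ?andbF //.
      by move: lC; rewrite inE => /andP[-> ->].
    have -> : Y = set0 by apply/setP => z; rewrite !inE; do 2!case: (z \in _).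
    by rewrite cards0 !subn0.
  by apply: subset_leq_card; rewrite !subUset DA1 DA2 sub1set.
(* Since [#|C1| <= #|C2| <= #|A|], both differences [C1 :\: C2] and [C2 :\: C1] have at least [#|D|]
   elements. If this is at least 2, they and [l] make up five points of [A]. Otherwise [D] is a
   single point of [C1], spanned by the rest of [C1], which lies in [A]. *)
have [D1|D2] := leqP #|D| 1; last first.
  by left; clear -D2 leA leC cD cI cUI c1 c2 cA; lia.
right; have /card_gt0P[x xD] : 0 < #|D|.
  rewrite card_gt0 setD_eq0; apply: contra C1A => /(subset_trans _); apply.
  exact: subsetUl.
have DE : D = [set x] by apply/eqP; rewrite eq_sym eqEcard sub1set xD cards1.
have xA : x \notin A by move: xD; rewrite inE => /andP[].
have xC1 : x \in C1.
  move: xD; rewrite !inE => /andP[_ /orP[//|xC2]]; apply: contraT => xC1.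
  by rewrite (subsetP DA2) // !inE xC1 in xA.
exists x; first by rewrite inE xA (subsetP C1E).
apply: (@closureS _ (C1 :\ x)); last by rewrite setD1K // C1cl.
apply/subsetP => z; rewrite !inE => /andP[zx zC1]; apply: contraT => zA.
have : z \in D by rewrite !inE zA zC1.
by rewrite DE inE (negPf zx).
Qed.

End Matroid.

(** In the sum of the hypothesis over all ordered pairs of distinct elements, each [f i] is counted
    [2 * (#|A| - 1)] times. *)
Lemma sum_le_of_pairs (I : finType) (A : {set I}) (f : I -> nat) (k : nat) :
    1 < #|A| ->
    (forall i j, i \in A -> j \in A -> i != j -> f i + f j <= k) ->
  2 * \sum_(i in A) f i <= #|A| * k.
Proof.
move=> A1 fk.
have lead i : i \in A ->
    (#|A| - 1) * f i + \sum_(j in A :\ i) f j <= (#|A| - 1) * k.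
  move=> iA; have cA : #|A :\ i| = #|A| - 1 by rewrite (cardsD1 i A) iA add1n subn1.
  rewrite -cA -!sum_nat_const -big_split /=; apply: leq_sum => j.
  by rewrite !inE eq_sym => /andP[ij jA]; apply: fk.
have : \sum_(i in A) ((#|A| - 1) * f i + \sum_(j in A :\ i) f j)
    <= \sum_(i in A) (#|A| - 1) * k by apply: leq_sum.
rewrite sum_nat_const.
have -> : \sum_(i in A) ((#|A| - 1) * f i + \sum_(j in A :\ i) f j)
    = (#|A| - 1) * (2 * \sum_(i in A) f i).
  rewrite mulnCA big_distrr /= big_distrr /=.
  have E i : i \in A -> (#|A| - 1) * f i + \sum_(j in A :\ i) f j + f i =
      (#|A| - 1) * f i + \sum_(j in A) f j.
    by move=> iA; rewrite [in RHS](big_setD1 i) //= -addnA [_ + f i]addnC.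
  apply: (@addIn (\sum_(i in A) f i)); rewrite -big_split /=.
  under eq_bigr => i iA do rewrite E //.
  rewrite big_split /= sum_nat_const -!big_distrr /=.
  by move: (\sum_(i in A) _) A1 => s; move: #|A| => a; nia.
rewrite [#|A| * _]mulnCA leq_pmul2l //; lia.
Qed.

(** * The rank inequality for the missing orders of vanishing *)

Section Demand.
Variables (I : finType) (r : {set I} -> nat) (rP : matroid_rank r).
Variables (E Q : {set I}) (mult c : I -> nat) (mu b : nat).
Let B := E :\: Q.

(* The order of vanishing at i that a monomial y^c does not provide, where y_j
   is dual to j in B and vanishes at i in Q when i is spanned by B :\ j. *)
Definition demand (i : I) : nat :=
  if i \in Q then mult i - \sum_(j in B | r (i |: B :\ j) == r (B :\ j)) c j
  else mult i - (mu - c i).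

Hypotheses (Q2 : #|Q| <= 2) (Bind : r B = #|B|).
Hypothesis QP : forall A : {set I},
    A \subset E -> Q \subset A -> #|Q| = 2 -> (r A).+1 = #|A| ->
    (forall x, x \in A -> r (A :\ x) = r A) ->
  forall l, l \in A :\: Q -> (forall q, q \in Q -> r (q |: B :\ l) != r (B :\ l)) ->
  5 <= #|A| \/ exists2 x, x \in E :\: A & r (x |: A) = r A.
Hypothesis mult_rank : forall A : {set I}, A \subset E -> A != set0 ->
  \sum_(i in A) mult i + mu <= r A * b.
Hypothesis mult_pair : forall i j, i \in E -> j \in E -> i != j ->
  mult i + mult j <= b.+1.
Hypothesis mult_mu : forall i, i \in E -> mu < mult i /\ mult i + mu <= b.
Hypothesis cB : \sum_(j in B) c j <= mu.

(** This is the hypothesis of Rado's theorem for [b - mu] copies of the matroid. Points of demand 0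
    and points not spanned by the rest of [A] are split off by induction. What remains follows from
    [mult_rank] by counting, unless [A] is a circuit through both points of [Q]. *)
Lemma demand_le (A : {set I}) : A \subset E ->
  \sum_(i in A) demand i <= r A * (b - mu).
Proof.
have [k] := ubnP #|A|; elim: k A => // k IHk A leAk AE.
have [->|A0] := eqVneq A set0; first by rewrite big_set0.
have IH x : x \in A -> \sum_(i in A :\ x) demand i <= r (A :\ x) * (b - mu).
  move=> xA; apply: IHk; last exact: subset_trans (subsetDl _ _) AE.
  by move: leAk; rewrite (cardsD1 x A) xA.
have cle i : i \in B -> c i <= mu.
  by move=> iB; apply: leq_trans cB; rewrite (big_setD1 i) //= leq_addr.
have dem_le i : i \in A -> demand i <= b - mu.
  move=> /(subsetP AE) iE; have [mu_lt lb] := mult_mu iE.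
  rewrite /demand; case: ifP => iQ; first by clear -lb; lia.
  have := cle i; rewrite inE iQ iE => /(_ isT); clear -lb mu_lt; lia.
have [/existsP[x /andP[xA /eqP dx]]|] := boolP [exists x, (x \in A) && (demand x == 0)].
  rewrite (big_setD1 x) //= dx; apply: leq_trans (IH x xA) _.
  by rewrite leq_mul2r (rankS rP) ?subsetDl ?orbT.
rewrite negb_exists => /forallP dpos.
(* A point whose removal lowers the rank is paid for by that rank, as no single demand exceeds
   [b - mu]. *)
have [/existsP[x /andP[xA rx]]|] := boolP [exists x, (x \in A) && (r (A :\ x) < r A)].
  rewrite (big_setD1 x) //=; apply: leq_trans (leq_add (dem_le x xA) (IH x xA)) _.
  by rewrite -mulSn leq_mul2r rx orbT.
rewrite negb_exists => /forallP nocl.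
have {}nocl x : x \in A -> r (A :\ x) = r A.
  move=> xA; have := nocl x; rewrite xA /= -leqNgt => h.
  by apply/eqP; rewrite eqn_leq h (rankS rP) ?subsetDl.
have A'B : A :\: Q \subset B by apply: setSD.
have A'ind := independentS rP A'B Bind.
have wle := mult_rank AE A0.
have cA' : \sum_(i in A :\: Q) c i <= mu.
  apply: leq_trans cB; rewrite [leqRHS](big_setID (A :\: Q)) /= (setIidPr A'B).
  exact: leq_addr.
have dA' : \sum_(i in A :\: Q) demand i + mu * #|A :\: Q| =
    \sum_(i in A :\: Q) mult i + \sum_(i in A :\: Q) c i.
  rewrite mulnC -sum_nat_const -!big_split /=; apply: eq_bigr => i iA'.
  have [iE iQ] : i \in E /\ i \notin Q.
    by move: (subsetP A'B i iA'); rewrite inE => /andP[].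
  have [mu_lt _] := mult_mu iE; have := cle i (subsetP A'B i iA').
  by rewrite /demand (negPf iQ); clear -mu_lt; lia.
have dQ : \sum_(i in A :&: Q) demand i <= \sum_(i in A :&: Q) mult i.
  apply: leq_sum => i; rewrite inE => /andP[_ iQ].
  by rewrite /demand iQ leq_subr.
move: wle; rewrite mulnBr (big_setID Q) /= => wle; rewrite (big_setID Q) /=.
(* Each point of [A :\: Q] saves [mu] up to its [c i]. The [c i] sum to at most [mu], which is the
   slack in [mult_rank]. *)
have [rA'|ltr] := leqP (r A) #|A :\: Q|.
  have : r A * mu <= mu * #|A :\: Q| by rewrite mulnC leq_mul2l rA' orbT.
  clear -wle dA' dQ cA'; lia.
have ltrA : r A < #|A|.
  have /card_gt0P[x xA] : 0 < #|A| by rewrite card_gt0.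
  rewrite -(nocl x xA) (cardsD1 x A) xA; exact: rank_le_card.
(* Now A is a circuit through both points of Q. *)
have cAQ := cardsID Q A.
have leIQ : #|A :&: Q| <= #|Q| by rewrite subset_leq_card ?subsetIr.
have IQ2 : #|A :&: Q| = 2 by clear -leIQ Q2 cAQ ltrA ltr; lia.
have cQ : #|Q| = 2 by clear -leIQ Q2 IQ2; lia.
have QA : Q \subset A by apply/setIidPr/eqP; rewrite eqEcard subsetIr IQ2 cQ.
have rA1 : (r A).+1 = #|A| by clear -IQ2 cAQ ltr ltrA; lia.
have rA' : r A = #|A :\: Q|.+1 by clear -rA1 cAQ IQ2; lia.
(* As [A :\: Q] has only [r A - 1] points, the count above falls short by [mu]. One more [mu] of
   slack in the rank bound repairs this. *)
have [wle2|wgt] := leqP (\sum_(i in A) mult i + 2 * mu) (r A * b).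
  move: wle2; rewrite (big_setID Q) /= => wle2.
  have : r A * mu = mu * #|A :\: Q| + mu by rewrite rA'; clear; lia.
  clear -wle2 dA' dQ cA'; lia.
(* Without that slack, no [l] with [c l > 0] can fail to help at both points of [Q]. By [QP], such
   an [l] would yield either a further point [x] spanned by [A], whose multiplicity exceeds [mu] and
   creates the slack, or at least five points in [A]. *)
have [/existsP[l]|] := boolP [exists l, [&& l \in A :\: Q, 0 < c l &
    [forall q in Q, r (q |: B :\ l) != r (B :\ l)]]].
  case/and3P => lA' cl /forall_inP lQ; exfalso.
  have muge : 0 < mu by apply: leq_trans cl (cle l (subsetP A'B l lA')).
  have [N5|[x xEA xcl]] := QP AE QA cQ rA1 nocl lA' lQ; last first.
    have [xE xA] : x \in E /\ x \notin A by move: xEA; rewrite inE => /andP[].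
    have xAE : x |: A \subset E by rewrite subUset sub1set xE.
    have xA0 : x |: A != set0 by apply/set0Pn; exists x; rewrite setU11.
    have := mult_rank xAE xA0; have [mux _] := mult_mu xE.
    by rewrite xcl big_setU1 //=; clear -wgt mux; lia.
  have h : 2 * \sum_(i in A) mult i <= #|A| * b.+1.
    apply: sum_le_of_pairs => [|i j /(subsetP AE) iE /(subsetP AE) jE].
      exact: leq_trans N5.
    exact: mult_pair.
  have /card_gt0P[y yA] : 0 < #|A| by clear -N5; lia.
  have [my1 my2] := mult_mu (subsetP AE y yA).
  (* With [n = r A >= 4], the pair bound [h], the missing slack [wgt] and [2 * mu < b] give
     [(n - 3) * b < n - 1]. This is absurd, since [mu > 0] makes [b >= 3]. *)
  clear -h wgt N5 my1 my2 rA1 muge; move: (\sum_(i in A) _) wgt h => w wgt h.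
  move: wgt h; rewrite -rA1 ltnNge => /negP + h; apply.
  have N4 : 4 <= r A by lia.
  move: (r A) N4 h {N5 rA1} => n N4 h; nia.
rewrite negb_exists => /forallP nol.
(* Now every [c l] is subtracted from the demand of some point of [Q], without truncation because
   all demands are positive. This cancels the [c l] that [l] adds to its own demand. *)
have dQ' : \sum_(i in A :&: Q) demand i + \sum_(i in A :\: Q) c i
    <= \sum_(i in A :&: Q) mult i.
  rewrite (setIidPr QA).
  have dq q : q \in Q ->
      demand q + \sum_(j in B | r (q |: B :\ j) == r (B :\ j)) c j
      = mult q.
    move=> qQ; have := dpos q; rewrite (subsetP QA) //= /demand qQ.
    by clear; lia.
  rewrite -(eq_bigr _ dq) big_split /= leq_add2l.
  rewrite (exchange_big_dep (mem B)) /=; last by move=> q j _ /andP[].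
  rewrite [leqRHS](big_setID (A :\: Q)) /= (setIidPr A'B).
  apply: leq_trans (leq_addr _ _); apply: leq_sum => l lA'.
  have lB := subsetP A'B l lA'.
  have := nol l; rewrite lA' /= negb_and -leqNgt leqn0 => /orP[/eqP->//|].
  rewrite negb_forall => /existsP[q]; rewrite negb_imply negbK => /andP[qQ rq].
  by rewrite (bigD1 q) /= ?qQ ?lB ?rq // leq_addr.
have : r A * mu = mu * #|A :\: Q| + mu by rewrite rA'; clear; lia.
clear -wle dA' dQ'; lia.
Qed.

End Demand.

(** * Projection from a point *)

Lemma sum_reindex_le (I J : finType) (P : {set I}) (R : pred J) (s : I -> J)
    (f : J -> nat) :
    {in P &, injective s} -> (forall i, i \in P -> R (s i)) ->
  \sum_(i in P) f (s i) <= \sum_(j | R j) f j.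
Proof.
move=> s_inj sR; rewrite -(big_imset f s_inj) /=.
rewrite [leqRHS](bigID (mem (s @: P))) /= -[leqLHS]addn0 leq_add //.
rewrite [leqRHS](eq_bigl (mem (s @: P))) // => j /=.
by rewrite andb_idl // => /imsetP[i iP ->]; apply: sR.
Qed.

Lemma dim_two_lines (K : fieldType) (V : vectType K) (u w : V) :
  w != 0%R -> u \notin <[w]>%VS -> \dim (<[u]> + <[w]>) = 2.
Proof.
move=> w0 uw; have u0 : u != 0%R by apply: contraNneq uw => ->; apply: mem0v.
apply/eqP; rewrite eqn_leq; apply/andP; split.
  by apply: leq_trans (dimv_add_leqif _ _) _; rewrite !dim_vline u0 w0.
rewrite ltnNge; apply/negP => dle.
have /eqP wE : <[w]>%VS == (<[u]> + <[w]>)%VS by rewrite eqEdim addvSr dim_vline w0.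
by have /negP[] := uw; rewrite wE memvE addvSl.
Qed.

Section PointRank.
Variables (K : fieldType) (V : vectType K) (I : finType) (v : I -> V) (p : I).
Implicit Types A B : {set I}.

(* prank is the rank of the images of the points in V / <v p>. *)
Definition pspan A : {vspace V} := (<[v p]> + \sum_(i in A) <[v i]>)%VS.
Definition prank A : nat := (\dim (pspan A)).-1.

Hypothesis vp0 : (v p != 0)%R.

Lemma dim_pspan A : \dim (pspan A) = (prank A).+1.
Proof.
rewrite /prank prednK //; have : \dim <[v p]> <= \dim (pspan A).
  by apply/dimvS/addvSl.
by rewrite dim_vline vp0.
Qed.

Lemma mem_pspan A i : i \in A -> v i \in pspan A.
Proof.
move=> iA; apply: (subvP (addvSr _ _)).
by rewrite memvE (sumv_sup i).
Qed.

Lemma pspanS A B : A \subset B -> (pspan A <= pspan B)%VS.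
Proof.
move=> AB; apply: addvS => //; apply/subv_sumP => i iA.
by rewrite (sumv_sup i) // (subsetP AB).
Qed.

Lemma pspanU1 x A : pspan (x |: A) = (<[v x]> + pspan A)%VS.
Proof.
apply/eqP; rewrite eqEsubv; apply/andP; split.
  rewrite subv_add; apply/andP; split.
    by apply: subv_trans (addvSr _ _); apply: addvSl.
  apply/subv_sumP => i; rewrite !inE => /predU1P[->|iA]; first exact: addvSl.
  by apply: subv_trans (addvSr _ _); rewrite -memvE mem_pspan.
by rewrite subv_add pspanS ?subsetUr // -memvE mem_pspan ?setU11.
Qed.

Lemma prank_matroid : matroid_rank prank.
Proof.
split.
- by rewrite /prank /pspan big_set0 addv0 dim_vline vp0.
- by move=> A B AB; have := dimvS (pspanS AB); rewrite !dim_pspan.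
- move=> x A; rewrite -ltnS -!dim_pspan pspanU1.
  apply: leq_trans (dimv_add_leqif _ _) _.
  by rewrite -add1n leq_add2r dim_vline; case: eqP.
- move=> A B; have H : (pspan (A :|: B) <= pspan A + pspan B)%VS.
    rewrite subv_add; apply/andP; split; first
      by apply/(subv_trans _ (addvSl _ _))/addvSl.
    apply/subv_sumP => i; rewrite inE -memvE => /orP[iA|iB].
      by apply: (subvP (addvSl _ _)); apply: mem_pspan.
    by apply: (subvP (addvSr _ _)); apply: mem_pspan.
  have H' : (pspan (A :&: B) <= pspan A :&: pspan B)%VS.
    by rewrite subv_cap !pspanS ?subsetIl ?subsetIr.
  have := dimv_sum_cap (pspan A) (pspan B).
  by have := dimvS H; have := dimvS H'; rewrite !dim_pspan; lia.
Qed.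

Lemma prank_closure x A : prank (x |: A) = prank A -> v x \in pspan A.
Proof.
move=> rx; have : (pspan A == pspan (x |: A))%VS.
  by rewrite eqEdim pspanS ?subsetUr //= !dim_pspan rx.
by move/eqP->; rewrite mem_pspan ?setU11.
Qed.

Lemma notin_span_independent A : prank A = #|A| ->
  v p \notin (\sum_(i in A) <[v i]>)%VS.
Proof.
move=> rA; apply/negP; rewrite memvE => /addv_idPr eA.
have := dim_pspan A; rewrite rA /pspan eA.
have : \dim (\sum_(i in A) <[v i]>) <= #|A|.
  apply: leq_trans (dimv_leq_sum _ _ _) _; rewrite -sum1_card leq_sum // => i _.
  by rewrite dim_vline; case: eqP.
by move=> + E; rewrite E ltnn.
Qed.

End PointRank.

(** * Independent sets of points that supply the missing orders *)

Section Cover.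
Variables (K : fieldType) (V : vectType K) (I : finType) (v : I -> V).
Variables (m : I -> nat) (b : nat) (p : I) (mu : nat).
Hypothesis v_neq0 : forall i, (v i != 0)%R.
Hypothesis v_distinct : forall i j, i != j -> v i \notin <[v j]>%VS.
Hypothesis nullity_le2 : #|I| <= \dim (\sum_i <[v i]>)%VS + 2.
Hypothesis segre : forall L : {vspace V}, 1 < \dim L ->
  \sum_(i | v i \in L) m i <= (\dim L).-1 * b + 1.
Hypothesis mp : m p = mu.+1.
Hypothesis m_min : forall i, 0 < m i -> m p <= m i.

Let E := [set i | (i != p) && (0 < m i)].
Let r := prank v p.
Let rP : matroid_rank r := prank_matroid (v_neq0 p).

Lemma support_nullity : #|E| <= r E + 2.
Proof.
have := nullity_le2; have -> : (\sum_i <[v i]>)%VS = pspan v p (~: [set p]).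
  rewrite /pspan (bigD1 p) //=; congr (_ + _)%VS.
  by apply: eq_bigl => i; rewrite !inE.
rewrite dim_pspan // -/r; have := rank_le_setD rP E (~: [set p]).
have EP : E \subset ~: [set p] by apply/subsetP => i; rewrite !inE => /andP[].
rewrite cardsDS //; have := subset_leq_card EP; rewrite cardsC1.
have : 0 < #|I| by apply/card_gt0P; exists p.
clear; lia.
Qed.

(** The span of [p] and [A] also contains [p], whose multiplicity [mu + 1] yields the term [mu] and
    absorbs the [+ 1] of the Segre bound. *)
Lemma support_rank (A : {set I}) : A \subset E -> A != set0 ->
  \sum_(i in A) m i + mu <= r A * b.
Proof.
move=> AE /set0Pn[x xA].
have pA : p \notin A by apply/negP => /(subsetP AE); rewrite inE eqxx.
have d1 : 1 < \dim (pspan v p A).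
  rewrite ltnNge; apply/negP => dle.
  have vpL : (<[v p]> <= pspan v p A)%VS by apply: addvSl.
  have /eqP pE : <[v p]>%VS == pspan v p A.
    by rewrite eqEdim vpL dim_vline v_neq0.
  have /v_distinct/negP[] : x != p by apply: contraNneq pA => <-.
  by rewrite pE mem_pspan.
have := segre d1; rewrite dim_pspan //= addn1 -/r => H.
rewrite -ltnS; apply: leq_trans H; rewrite -addnS -mp addnC -big_setU1 //=.
rewrite [leqRHS](bigID (mem (p |: A))) /= -[leqLHS]addn0 leq_add //.
apply/eq_leq/eq_bigl => i /=; rewrite andb_idl // !inE => /predU1P[->|iA].
  by rewrite memvE addvSl.
exact: mem_pspan.
Qed.

Lemma support_pair i j : i != j -> m i + m j <= b.+1.
Proof.
move=> ij; have := @segre (<[v i]> + <[v j]>)%VS.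
rewrite dim_two_lines ?v_distinct //.
move=> /(_ isT); rewrite mul1n addn1; apply: leq_trans.
rewrite (bigD1 i) /= ?memvE ?addvSl // (bigD1 j) /= ?memvE ?addvSr ?(eq_sym j) //.
by rewrite addnA leq_addr.
Qed.

Lemma support_mult i : i \in E -> mu < m i /\ m i + mu <= b.
Proof.
rewrite inE => /andP[ip mi0]; rewrite -mp; split; first exact: m_min.
by have := support_pair ip; rewrite mp addnS.
Qed.

(** Independence of [B] modulo [v p] makes [v p] and the [v i] together free; a basis of a
    complement completes them. The injection [s] records the positions, and position 0 is kept for
    [v p]. *)
Lemma extend_basis (B : {set I}) (N : nat) : \dim {:V} = N.+1 ->
    p \notin B -> r B = #|B| ->
  exists2 X : N.+1.-tuple V, basis_of fullv X & (X`_0)%R = v p /\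
    exists2 s : I -> 'I_N.+1, {in B &, injective s} &
      forall i, i \in B -> s i != ord0 /\ (X`_(s i))%R = v i.
Proof.
move=> dimV pB rB; pose S := v p :: [seq v i | i <- enum B].
have spanS : <<S>>%VS = pspan v p B.
  by rewrite /S span_cons span_def big_map big_enum.
have szS : size S = #|B|.+1 by rewrite /= size_map -cardE.
have freeS : free S by rewrite /free spanS dim_pspan // -/r rB szS.
pose Xs := S ++ vbasis (<<S>>^C)%VS.
have Xbasis : basis_of fullv Xs.
  rewrite -(addv_complf <<S>>%VS) cat_basis ?vbasisP //.
    by apply/directv_addP; rewrite capv_compl.
  by rewrite /basis_of eqxx.
have szX : size Xs == N.+1.
  by rewrite -dimV (@vector.size_basis _ _ _ _ (in_tuple Xs)).
exists (Tuple szX) => //; split=> //.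
pose s i : 'I_N.+1 := inord (index i (enum B)).+1.
have sE i : i \in B -> s i = (index i (enum B)).+1 :> nat.
  move=> iB; rewrite inordK // -(eqP szX) size_cat szS ltnS.
  by rewrite (leq_trans _ (leq_addr _ _)) // cardE index_mem mem_enum.
exists s => [i j iB jB /(congr1 val)/=|i iB].
  rewrite !sE // => -[/(congr1 (nth p (enum B)))].
  by rewrite !nth_index ?mem_enum.
have lt : index i (enum B) < size (enum B) by rewrite index_mem mem_enum.
split; first by rewrite -val_eqE /= sE.
rewrite /= sE //= nth_cat size_map lt (nth_map p) // nth_index ?mem_enum //.
Qed.

(** Rado's theorem is applied to [t] disjoint copies of the matroid, with [dem i] indices for each
    [i], all to be sent to copies of [i]. The set [S k] collects the points chosen in the copy
    [k]. *)
Lemma rado_cover (dem : I -> nat) (t : nat) :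
    (forall A : {set I}, \sum_(i in A) dem i <= r A * t) ->
  exists2 S : 'I_t -> {set I}, forall k, r (S k) = #|S k| &
    forall i, dem i <= #|[set k | i \in S k]|.
Proof.
move=> Hdem; pose T := {i : I & 'I_(dem i)}.
pose fib (Y : {set I * 'I_t}) k := [set i | (i, k) \in Y].
pose R (Y : {set I * 'I_t}) := \sum_k r (fib Y k).
have [||||f fA fR] := @rado_transversal T _ R _ _ _
    (fun x => [set y | y.1 == tag x]).
- rewrite /R big1 // => k _; rewrite (_ : fib _ _ = set0) ?(rank0 rP) //.
  by apply/setP => i; rewrite !inE.
- move=> Y Z YZ; apply: leq_sum => k _; apply: (rankS rP).
  by apply/subsetP => i; rewrite !inE; apply: (subsetP YZ).
- move=> Y Z; rewrite /R -!big_split /=; apply: leq_sum => k _.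
  rewrite (_ : fib (Y :|: Z) k = fib Y k :|: fib Z k); last first.
    by apply/setP => i; rewrite !inE.
  rewrite (_ : fib (Y :&: Z) k = fib Y k :&: fib Z k) ?(rank_submod rP) //.
  by apply/setP => i; rewrite !inE.
- move=> J; pose A := [set tag x | x in J].
  apply: (@leq_trans (r A * t)).
    apply: leq_trans (Hdem A); pose F i (j : 'I_(dem i)) := 1.
    have -> : \sum_(i in A) dem i = \sum_(i in A) \sum_(j < dem i) F i j.
      by apply: eq_bigr => i _; rewrite sum1_card card_ord.
    rewrite sig_big_dep /= sum1_card; apply/subset_leq_card/subsetP => x xJ.
    by rewrite unfold_in /= andbT; apply/imsetP; exists x.
  rewrite mulnC -[X in X * _]card_ord -sum_nat_const; apply: leq_sum => k _.
  apply: (rankS rP); apply/subsetP => _ /imsetP[x xJ ->]; rewrite /fib inE.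
  by apply/bigcupP; exists x => //; rewrite inE.
pose Y := f @: [set: T].
have leT := fR [set: T]; have leY : #|Y| <= #|[set: T]| := leq_imset_card f _.
have cY : #|Y| = \sum_k #|fib Y k|.
  transitivity (\sum_k \sum_(i | (i, k) \in Y) 1).
    rewrite (exchange_big_dep xpredT) //= pair_big_dep /= -sum1_card.
    by apply: eq_bigl => -[].
  by apply: eq_bigr => k _; rewrite sum1_card cardsE.
(* The chain [#|T| <= R Y <= #|Y| <= #|T|] collapses: every slice of [Y] is independent and [f] is
   injective. *)
have [leRY eqRY] :=
  leqif_sum (fun k (_ : true) => leqif_eq (rank_le_card rP (fib Y k))).
have eqT : #|[set: T]| = #|Y|.
  by apply/eqP; rewrite eqn_leq leY cY (leq_trans _ leRY).
have eqr k : r (fib Y k) = #|fib Y k|.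
  move/esym: eqRY; rewrite eqn_leq leRY -cY -eqT leT.
  by move/forallP/(_ k)/eqP.
exists (fib Y) => // i.
have f_inj : injective f.
  have /imset_injP f_inj : #|f @: [set: T]| == #|[set: T]| by rewrite -/Y -eqT.
  by move=> x y; apply: f_inj; rewrite inE.
pose g (j : 'I_(dem i)) := (f (Tagged (fun i => 'I_(dem i)) j)).2.
have fE j : f (Tagged (fun i => 'I_(dem i)) j) = (i, g j).
  rewrite [LHS]surjective_pairing; congr pair.
  by have := fA (Tagged (fun i => 'I_(dem i)) j); rewrite inE => /eqP.
have g_inj : injective g.
  move=> j j' gj; have /f_inj/eqP : f (Tagged (fun i => 'I_(dem i)) j) =
      f (Tagged (fun i => 'I_(dem i)) j') by rewrite !fE gj.
  by rewrite eq_Tagged => /eqP.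
rewrite -[leqLHS]card_ord -cardsT -(card_imset _ g_inj).
apply/subset_leq_card/subsetP => _ /imsetP[j _ ->].
by rewrite !inE -fE imset_f.
Qed.

(** Each [S k] will be the zero set prescribed for one linear factor that does not vanish at [p].
    The last sum is the order that the monomial with exponents [c] already has at [v i]. The basis
    [X] is chosen before [c], so that it serves all monomials. *)
Lemma cover_exists (N : nat) : \dim {:V} = N.+1 ->
  exists2 X : N.+1.-tuple V, basis_of fullv X & (X`_0)%R = v p /\
  forall c : 'I_N.+1 -> nat, \sum_(k | k != ord0) c k = mu ->
  exists2 S : 'I_(b - mu) -> {set I},
    forall k, v p \notin (\sum_(i in S k) <[v i]>)%VS &
    forall i, i != p -> m i <=
      #|[set k | i \in S k]| +
      \sum_(k | (k != ord0) && (coord X k (v i) == 0%R)) c k.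
Proof.
move=> dimV; have [Q [QE Q2 Bind rBE QP]] := basis_complement rP support_nullity.
set B := E :\: Q in Bind rBE QP.
have pB : p \notin B by rewrite !inE eqxx andbF.
have [X Xbasis [X0 [s s_inj sP]]] := extend_basis dimV pB Bind.
have Xfree := basis_free Xbasis.
exists X => //; split=> // c cmu.
have coordB i k : i \in B -> coord X k (v i) = (k == s i)%:R%R.
  by move=> /sP[_ <-]; rewrite coord_free // eq_sym.
have coordp k : coord X k (v p) = (k == ord0)%:R%R.
  by rewrite -X0 -[0]/(val (@ord0 N)) coord_free // eq_sym.
(* The coordinate dual to [j] kills [v p] and all of [B :\ j], hence whatever they span. This turns
   the rank condition in [demand] into actual vanishing. *)
have coordQ i j : j \in B -> r (i |: B :\ j) = r (B :\ j) ->
    coord X (s j) (v i) = 0%R.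
  move=> jB /(prank_closure (v_neq0 p)).
  case/memv_addP => _ /vlineP[a ->] [_ /memv_sumP[u uP ->] ->].
  rewrite linearD linearZ /= coordp (negPf (sP j jB).1) mulr0 add0r linear_sum.
  rewrite big1 // => l lB; have /vlineP[x ->] := uP l lB.
  move: lB; rewrite !inE => /and3P[lj lQ lE].
  rewrite linearZ /= coordB ?inE ?lQ //.
  case: eqP => [/s_inj|]; last by rewrite mulr0.
  by rewrite jB !inE lQ lE => /(_ isT isT) jl; rewrite jl eqxx in lj.
pose c' i := c (s i).
have c'mu : \sum_(j in B) c' j <= mu.
  by rewrite -cmu; apply: sum_reindex_le => // i /sP[].
(* The rank inequality is known for subsets of [E] only, so the demand is cut off outside [E]. *)
pose dem i := if i \in E then demand r E Q m c' mu i else 0.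
have [A|S Sind Scov] := @rado_cover dem (b - mu).
  have -> : \sum_(i in A) dem i = \sum_(i in A :&: E) demand r E Q m c' mu i.
    by rewrite [RHS]big_mkcond [LHS]big_mkcond; apply: eq_bigr => i _;
      rewrite /dem !inE; case: (i \in A); case: (i \in E).
  apply: leq_trans (leq_mul (rankS rP (subsetIl A E)) (leqnn _)).
  apply: demand_le => //; last exact: subsetIr.
  - exact: support_rank.
  - by move=> i j _ _; apply: support_pair.
  - exact: support_mult.
exists S => [k|i ip]; first exact: notin_span_independent.
have [->//|mi0] := posnP (m i).
have iE : i \in E by rewrite inE ip.
apply: leq_trans (leq_add (Scov i) (leqnn _)); rewrite /dem iE /demand.
have le_sub x y : x <= y -> m i <= m i - x + y by clear; lia.
case: ifP => iQ; apply: le_sub.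
  pose P := [set j in B | r (i |: B :\ j) == r (B :\ j)].
  have PP j : (j \in P) = (j \in B) && (r (i |: B :\ j) == r (B :\ j)).
    by rewrite inE.
  rewrite -(eq_bigl _ _ PP); apply: sum_reindex_le => [j l|j]; rewrite !PP.
    by move=> /andP[jB _] /andP[lB _]; apply: s_inj.
  by move=> /andP[jB /eqP rj]; rewrite (sP j jB).1 coordQ /=.
have iB : i \in B by rewrite inE iQ.
rewrite leq_subLR -cmu (bigD1 (s i)) /= ?(sP i iB).1 // leq_add2l.
apply/eq_leq/eq_bigl => k; rewrite coordB //.
by case: (k == s i); rewrite ?eqxx ?oner_eq0.
Qed.

End Cover.

Local Open Scope ring_scope.

(** * Order of vanishing *)

Section IdealPow.
Variables (A : comNzRingType) (I : A -> Prop).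

Lemma ideal_pow_0 m : ideal_pow I m 0.
Proof. by exists 0%N, (fun=> 0), (fun j _ => 0); split=> [[]//|]; rewrite big_ord0. Qed.

Lemma ideal_powD m f g : ideal_pow I m f -> ideal_pow I m g -> ideal_pow I m (f + g).
Proof.
case=> t [a [h [hI ->]]] [t' [a' [h' [h'I ->]]]].
exists (t + t')%N, (fun j => match split j with inl i => a i | inr i => a' i end).
exists (fun j => match split j with inl i => h i | inr i => h' i end).
split=> [j k|]; first by case: split.
rewrite big_split_ord /=; congr (_ + _); apply: eq_bigr => j _.
  by case: split (@unsplitK t t' (inl j)) => ? // [->].
by case: split (@unsplitK t t' (inr j)) => ? // [->].
Qed.

Lemma ideal_pow_sum m (J : Type) (s : seq J) (P : pred J) (F : J -> A) :
  (forall j, P j -> ideal_pow I m (F j)) -> ideal_pow I m (\sum_(j <- s | P j) F j).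
Proof.
move=> H; apply: (big_ind (ideal_pow I m)) => //; first exact: ideal_pow_0.
exact: ideal_powD.
Qed.

Lemma ideal_powMl m c f : ideal_pow I m f -> ideal_pow I m (c * f).
Proof.
case=> t [a [h [hI ->]]]; exists t, (fun j => c * a j), h; split=> //.
by rewrite mulr_sumr; apply: eq_bigr => j _; rewrite mulrA.
Qed.

Lemma ideal_pow_exp0 f : ideal_pow I 0 f.
Proof.
exists 1%N, (fun=> f), (fun _ _ => 0); split=> [_ []//|].
by rewrite big_ord_recl !big_ord0 addr0 mulr1.
Qed.

Lemma ideal_powS m g f : I g -> ideal_pow I m f -> ideal_pow I m.+1 (g * f).
Proof.
move=> Ig [t [a [h [hI ->]]]].
exists t, a, (fun j k => if unlift ord0 k is Some k' then h j k' else g).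
split=> [j k|]; first by case: unliftP.
rewrite mulr_sumr; apply: eq_bigr => j _.
rewrite big_ord_recl unlift_none mulrCA; congr (_ * (_ * _)).
by apply: eq_bigr => k _; rewrite liftK.
Qed.

Lemma ideal_pow_pred m f : ideal_pow I m.+1 f -> ideal_pow I m f.
Proof.
case=> t [a [h [hI ->]]].
exists t, (fun j => a j * h j ord0), (fun j k => h j (lift ord0 k)); split=> //.
by apply: eq_bigr => j _; rewrite big_ord_recl mulrA.
Qed.

Lemma ideal_pow_le m m' f : (m <= m')%N -> ideal_pow I m' f -> ideal_pow I m f.
Proof.
elim: m' => [|m' IHm]; first by rewrite leqn0 => /eqP->.
by rewrite leq_eqVlt => /predU1P[->//|le] /ideal_pow_pred; apply: IHm.
Qed.

Lemma ideal_pow_exp m k g f : I g -> ideal_pow I m f -> ideal_pow I (k + m) (g ^+ k * f).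
Proof.
move=> Ig If; elim: k => [|k IHk]; first by rewrite mul1r.
by rewrite exprS -mulrA addSn; apply: ideal_powS.
Qed.

Lemma ideal_pow_prod (J : finType) (P : pred J) (g : J -> A) (a : J -> nat) :
  (forall j, P j -> I (g j)) ->
  ideal_pow I (\sum_(j | P j) a j) (\prod_(j | P j) g j ^+ a j).
Proof.
move=> gI; apply: (big_rec2 (fun y1 y2 => ideal_pow I y1 y2)).
  exact: ideal_pow_exp0.
by move=> j y1 y2 Pj; apply: ideal_pow_exp; apply: gI.
Qed.

End IdealPow.

Lemma dhomog_prod_exp (R : comNzRingType) (n : nat) (J : finType) (P : pred J)
    (g : J -> {mpoly R[n]}) (d a : J -> nat) :
    (forall j, P j -> g j \is (d j).-homog) ->
  \prod_(j | P j) g j ^+ a j \is (\sum_(j | P j) d j * a j)%N.-homog.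
Proof.
move=> gd.
apply: (big_rec2 (fun (e : nat) (f : {mpoly R[n]}) => f \is e.-homog)).
  exact: dhomog1.
by move=> j y1 y2 /gd gj hy; apply: dhomogM => //; apply: dhomogMn.
Qed.

Lemma dhomog_sum (R : nzRingType) (n d : nat) (J : Type) (s : seq J) (P : pred J)
    (F : J -> {mpoly R[n]}) :
  (forall j, P j -> F j \is d.-homog) -> \sum_(j <- s | P j) F j \is d.-homog.
Proof.
move=> H; apply: (big_ind (fun f : {mpoly R[n]} => f \is d.-homog)) => //.
  exact: dhomog0.
exact: dhomogD.
Qed.

Section Order.
Variables (K : fieldType) (n : nat).
Local Notation R := {mpoly K[n.+1]}.
Implicit Types (v u : 'rV[K]_n.+1) (f g : R).

Definition ev v f : K := f.@[fun i => v ord0 i].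

(* f restricted to the line through v with generic direction (X_0, ..., X_n) *)
Definition germ v : R -> {poly R} :=
  mmap (polyC \o @mpolyC n.+1 K) (fun i => (v ord0 i)%:MP%:P + ('X_i)%:P * 'X).

HB.instance Definition _ v := GRing.RMorphism.on (germ v).

(** The coefficients of the germ collect the Hasse derivatives of [f] at [v], so this measures the
    order of vanishing in every characteristic. *)
Definition vanish v (k : nat) f := exists q : {poly R}, germ v f = q * 'X^k.

Lemma germD v f g : germ v (f + g) = germ v f + germ v g.
Proof. exact: rmorphD. Qed.

Lemma germM v f g : germ v (f * g) = germ v f * germ v g.
Proof. exact: rmorphM. Qed.

Lemma germZ v c f : germ v (c *: f) = c%:MP%:P * germ v f.
Proof. by rewrite /germ mmapZ. Qed.

Lemma germ_coef0 v f : (germ v f)`_0 = (ev v f)%:MP.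
Proof.
rewrite -horner_coef0 /germ /mmap /ev mevalE horner_sum rmorph_sum /=.
apply: eq_bigr => a _; rewrite hornerM hornerC rmorphM /=; congr (_ * _).
rewrite /mmap1 horner_prod rmorph_prod; apply: eq_bigr => i _.
by rewrite horner_exp !hornerE rmorphXn.
Qed.

Lemma poly_coef0_split (S : nzRingType) (q : {poly S}) :
  exists q', q = (q`_0)%:P + q' * 'X.
Proof.
elim/poly_ind: q => [|q c _]; first by exists 0; rewrite coef0 mul0r addr0.
by exists q; rewrite coefD coefMX coefC /= add0r addrC.
Qed.

Lemma germ_ev v f : exists q, germ v f = (ev v f)%:MP%:P + q * 'X.
Proof. by rewrite -germ_coef0; apply: poly_coef0_split. Qed.

Lemma vanish0 v k : vanish v k 0.
Proof. by exists 0; rewrite rmorph0 mul0r. Qed.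

Lemma vanish_exp0 v f : vanish v 0 f.
Proof. by exists (germ v f); rewrite mulr1. Qed.

Lemma vanishD v k f g : vanish v k f -> vanish v k g -> vanish v k (f + g).
Proof. by case=> q Eq [q' Eq']; exists (q + q'); rewrite germD Eq Eq' mulrDl. Qed.

Lemma vanishMl v k f g : vanish v k g -> vanish v k (f * g).
Proof. by case=> q Eq; exists (germ v f * q); rewrite germM Eq mulrA. Qed.

Lemma vanishN v k f : vanish v k f -> vanish v k (- f).
Proof. by rewrite -mulN1r; apply: vanishMl. Qed.

Lemma vanishM v k l f g : vanish v k f -> vanish v l g -> vanish v (k + l) (f * g).
Proof.
by case=> q Eq [q' Eq']; exists (q * q'); rewrite germM Eq Eq' mulrACA -exprD.
Qed.

Lemma vanish_le v k l f : (k <= l)%N -> vanish v l f -> vanish v k f.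
Proof. by move/subnK <- => -[q Eq]; exists (q * 'X^(l - k)); rewrite Eq exprD mulrA. Qed.

Lemma vanish_sum v k (J : Type) (s : seq J) (P : pred J) (F : J -> R) :
  (forall j, P j -> vanish v k (F j)) -> vanish v k (\sum_(j <- s | P j) F j).
Proof.
move=> H; apply: (big_ind (vanish v k)); first exact: vanish0.
  exact: vanishD.
exact: H.
Qed.

Lemma vanish_ev v f : ev v f = 0 -> vanish v 1 f.
Proof. by move=> f0; have [q Eq] := germ_ev v f; exists q; rewrite Eq f0 add0r. Qed.

Lemma vanish_prod v (J : finType) (P : pred J) (g : J -> R) (a : J -> nat) :
  vanish v (\sum_(j | P j && (ev v (g j) == 0)) a j) (\prod_(j | P j) g j ^+ a j).
Proof.
rewrite big_mkcondr /=; apply: (big_rec2 (fun k f => vanish v k f)).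
  exact: vanish_exp0.
move=> j k f _; apply: vanishM.
case: eqP => [/vanish_ev gj|_]; last exact: vanish_exp0.
elim: (a j) => [|l IHl]; first exact: vanish_exp0.
by rewrite exprS -add1n; apply: vanishM.
Qed.

Lemma mulX_coprime_poly (q z q' : {poly R}) k : z`_0 != 0 ->
  q * z = q' * 'X^k -> exists q'', q = q'' * 'X^k.
Proof.
move=> z0; elim: k q q' => [|k IHk] q q' E; first by exists q; rewrite mulr1.
have [q1 Eq] := poly_coef0_split q.
have q0 : q`_0 = 0.
  have /eqP : (q * z)`_0 = 0 by rewrite E exprSr mulrA coefMX.
  by rewrite coef0M mulf_eq0 (negPf z0) orbF => /eqP.
rewrite q0 add0r in Eq; have [|q2 E2] := IHk q1 q'.
  by apply: (mulIf (negbT (polyX_eq0 _))); rewrite mulrAC -Eq E exprSr mulrA.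
by exists q2; rewrite Eq E2 -mulrA -exprSr.
Qed.

Lemma vanish_cancel v k f z : ev v z != 0 -> vanish v k (f * z) -> vanish v k f.
Proof.
move=> z0 [q]; rewrite germM => E; apply: mulX_coprime_poly E.
by rewrite germ_coef0 mpolyC_eq0.
Qed.

Lemma ideal_pow_vanish (P : proj_point K n) v k f : v \in val P -> v != 0 ->
  ideal_pow (point_ideal P) k f -> vanish v k f.
Proof.
move=> vP v0 [t [a [g [gI ->]]]]; apply: vanish_sum => j _; apply: vanishMl.
have := vanish_prod v xpredT (g j) (fun _ => 1%N).
under eq_bigl => i do rewrite /ev (gI j i v vP v0) eqxx.
by rewrite sum1_card card_ord; under eq_bigr => i _ do rewrite expr1.
Qed.

Definition lin (a : 'I_n.+1 -> K) : R := \sum_i a i *: 'X_i.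

Lemma lin_homog a : lin a \is 1.-homog.
Proof. by apply: dhomog_sum => i _; rewrite dhomogZ // dhomogX /= mdeg1. Qed.

Lemma ev_lin a v : ev v (lin a) = \sum_i a i * v ord0 i.
Proof.
by rewrite /ev /lin raddf_sum; apply: eq_bigr => i _; rewrite /= mevalZ mevalXU.
Qed.

Lemma germ_lin v a : germ v (lin a) = (ev v (lin a))%:MP%:P + (lin a)%:P * 'X.
Proof.
rewrite ev_lin /lin !rmorph_sum /= mulr_suml -big_split; apply: eq_bigr => i _ /=.
rewrite germZ /germ mmapX mmap1U mulrDr -mul_mpolyC !rmorphM /= mulrA.
by [].
Qed.

(** The entries of a projection with kernel [U] are linear forms that vanish on [U], and one of them
    is nonzero at [v]. *)
Lemma separating_form (U : {vspace 'rV[K]_n.+1}) v : v \notin U ->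
  exists a, ev v (lin a) != 0 /\ forall u, u \in U -> ev u (lin a) = 0.
Proof.
move=> vU; pose pr := (\1 - projv U)%VF.
have evE i u : ev u (lin (fun k => pr (delta_mx 0 k) ord0 i)) = pr u ord0 i.
  rewrite ev_lin {2}[u]row_sum_delta linear_sum summxE; apply: eq_bigr => k _.
  by rewrite linearZ mxE mulrC.
have prU u : (pr u == 0) = (u \in U).
  rewrite /pr add_lfunE opp_lfunE id_lfunE subr_eq0.
  by apply/eqP/idP => [->|/projv_id->//]; apply: memv_proj.
have : pr v != 0 by rewrite prU.
case/rV0Pn => i vi; exists (fun k => pr (delta_mx 0 k) ord0 i).
by rewrite evE; split=> // u; rewrite -prU evE => /eqP->; rewrite mxE.
Qed.

(** * Taylor expansion of forms at a point *)

Section Frame.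
Variable (X : n.+1.-tuple 'rV[K]_n.+1).
Hypothesis Xbasis : basis_of fullv X.

Definition frame_coord (k : 'I_n.+1) : R := lin (fun i => coord X k (delta_mx 0 i)).

Lemma ev_frame_coord k v : ev v (frame_coord k) = coord X k v.
Proof.
rewrite ev_lin [in RHS](row_sum_delta v) linear_sum; apply: eq_bigr => i _.
by rewrite linearZ mulrC.
Qed.

Lemma frame_var (i : 'I_n.+1) : 'X_i = \sum_(k < n.+1) X`_k ord0 i *: frame_coord k.
Proof.
transitivity (\sum_j (delta_mx 0 j : 'rV[K]_n.+1) ord0 i *: ('X_j : R)).
  rewrite (bigD1 i) //= mxE !eqxx scale1r big1 ?addr0 // => j ji.
  by rewrite mxE eqxx eq_sym (negPf ji) scale0r.
under [RHS]eq_bigr => k _ do rewrite scaler_sumr.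
rewrite exchange_big; apply: eq_bigr => j _ /=.
rewrite {1}(coord_basis Xbasis (memvf (delta_mx 0 j))) summxE scaler_suml.
by apply: eq_bigr => k _; rewrite mxE scalerA mulrC.
Qed.

(** The substitution [l] rewrites [f] in the coordinates dual to [X]; by [frame_var], putting these
    coordinates back for the variables undoes it. *)
Lemma frame_expansion d f : f \is d.-homog -> exists2 g, g \is d.-homog &
  f = \sum_(a <- msupp g) g@_a *: \prod_k frame_coord k ^+ a k.
Proof.
move=> fd; pose l := [tuple (lin (fun k : 'I_n.+1 => X`_k ord0 i)) | i < n.+1].
pose y := [tuple frame_coord k | k < n.+1].
exists (f \mPo l).
  rewrite comp_mpolyE big_seq_cond; apply: dhomog_sum => a; rewrite andbT => af.
  apply: dhomogZ; have -> : d = (\sum_(i < n.+1) 1 * a i)%N.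
    by rewrite -(dhomog_mf fd af) /= mdegE; apply: eq_bigr => i _; rewrite mul1n.
  by apply: dhomog_prod_exp => i _; rewrite tnth_mktuple lin_homog.
transitivity ((f \mPo l) \mPo y); last first.
  rewrite [LHS]comp_mpolyE; apply: eq_bigr => a _; congr (_ *: _).
  by apply: eq_bigr => k _; rewrite tnth_mktuple.
rewrite [f \mPo l]comp_mpolyEX raddf_sum {1}[f]mpolyE; apply: eq_bigr => a _ /=.
rewrite !comp_mpolyZ; congr (_ *: _).
rewrite comp_mpolyX /= mpolyXE_id rmorph_prod /=; apply: eq_bigr => i _.
rewrite rmorphXn /= tnth_mktuple; congr (_ ^+ _).
rewrite frame_var [RHS]raddf_sum; apply: eq_bigr => k _ /=.
by rewrite comp_mpolyZ comp_mpolyXU nth_mktuple.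
Qed.

Local Notation y := frame_coord.
Local Notation v := (X`_0).

Definition tail_mon (a : 'X_{1..n.+1}) : R := \prod_(k | k != ord0) y k ^+ a k.
Definition tail_deg (a : 'X_{1..n.+1}) : nat := (\sum_(k | k != ord0) a k)%N.

Lemma ev_frame_point k : ev v (y k) = (k == ord0)%:R.
Proof.
rewrite ev_frame_coord -[0%N]/(val (@ord0 n)).
by rewrite coord_free ?(basis_free Xbasis) // eq_sym.
Qed.

(** The factors vanish at [v], so their germs have no constant term. A form in these coordinates is
    therefore its own leading form at [v]. *)
Lemma germ_tail_mon a : germ v (tail_mon a) = (tail_mon a)%:P * 'X^(tail_deg a).
Proof.
rewrite /tail_mon /tail_deg.
apply: (big_ind2 (fun k f => germ v f = f%:P * 'X^k)).
- by rewrite /germ rmorph1 mulr1.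
- by move=> k1 f1 k2 f2 E1 E2; rewrite germM E1 E2 polyCM exprD mulrACA.
move=> k k0; rewrite /germ rmorphXn /= -/(germ v (y k)) germ_lin ev_frame_point.
by rewrite (negPf k0) mpolyC0 polyC0 add0r exprMn_comm ?rmorphXn //; apply: mulrC.
Qed.

Lemma taylor d f : f \is d.-homog -> exists F : nat -> R,
  [/\ f = \sum_(j < d.+1) y ord0 ^+ (d - j) * F j,
      forall j, germ v (F j) = (F j)%:P * 'X^j
    & forall j, exists (s : seq 'X_{1..n.+1}) (c : 'X_{1..n.+1} -> K),
        (forall a, a \in s -> tail_deg a = j) /\
        F j = \sum_(a <- s) c a *: tail_mon a].
Proof.
case/frame_expansion => g gd ->.
pose s j := [seq a <- msupp g | tail_deg a == j].
have sj j a : a \in s j -> tail_deg a = j by rewrite mem_filter => /andP[/eqP].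
exists (fun j => \sum_(a <- s j) g@_a *: tail_mon a); split; last 2 first.
- move=> j; rewrite {1}/germ rmorph_sum /= rmorph_sum /= mulr_suml.
  rewrite !big_seq; apply: eq_bigr => a /sj aj.
  by rewrite -/(germ v _) germZ germ_tail_mon aj mulrA -mul_mpolyC polyCM.
- by move=> j; exists (s j), (fun a => g@_a); split=> // a; apply: sj.
transitivity (\sum_(j < d.+1) \sum_(a <- msupp g | tail_deg a == j)
    y ord0 ^+ (d - j) * (g@_a *: tail_mon a)); last first.
  by apply: eq_bigr => j _; rewrite big_filter mulr_sumr.
rewrite (exchange_big_dep xpredT) //= !big_seq; apply: eq_bigr => a ag.
have da : d = (a ord0 + tail_deg a)%N.
  by rewrite -(dhomog_mf gd ag) /= mdegE (bigD1 ord0).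
have lt : (tail_deg a < d.+1)%N by rewrite ltnS da leq_addl.
rewrite (big_pred1 (Ordinal lt)) => [|j]; last by rewrite /= -val_eqE /= eq_sym.
by rewrite /= {1}da addnK -scalerAr (bigD1 ord0).
Qed.

(** Since [y ord0] has value 1 at [v], the coefficient of ['X^j] in the germ is [F j] once all
    earlier [F i] are known to be 0. *)
Lemma vanish_taylor d k (F : nat -> R) :
    (forall j, germ v (F j) = (F j)%:P * 'X^j) ->
    vanish v k (\sum_(j < d.+1) y ord0 ^+ (d - j) * F j) ->
  forall j, (j < k)%N -> (j <= d)%N -> F j = 0.
Proof.
move=> pF [q Eq] j; have [l] := ubnP j; elim: l j => // l IHl j jl jk jd.
have /eqP : (q * 'X^k)`_j = 0 by rewrite coefMXn jk.
rewrite -Eq {1}/germ rmorph_sum coef_sum (bigD1 (Ordinal (jd : (j < d.+1)%N))) //=.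
rewrite big1 ?addr0 => [|i ij]; rewrite -/(germ v _) germM pF.
  rewrite mulrA coefMXn ltnn subnn coef0M coefC /= /germ rmorphXn /=.
  rewrite -/(germ v (y ord0)).
  rewrite -horner_coef0 horner_exp horner_coef0 germ_coef0 ev_frame_point eqxx.
  by rewrite mpolyC1 expr1n mul1r => /eqP.
rewrite mulrA coefMXn; case: ltnP => // ji.
have {}ij : (i < j)%N by rewrite ltn_neqAle ij.
have -> : F i = 0.
  apply: IHl; last exact: leq_trans (ltnW ij) jd; last exact: ltn_trans ij jk.
  exact: leq_trans ij jl.
by rewrite polyC0 mulr0 coef0.
Qed.

(** The Taylor terms of degree below [k] are 0, and every other monomial has at least [k] factors
    from the point ideal. *)
Lemma vanish_ideal_pow (P : proj_point K n) d k f : val P = <[v]>%VS ->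
  f \is d.-homog -> vanish v k f -> ideal_pow (point_ideal P) k f.
Proof.
move=> PE /taylor[F [-> pF Fs]] vf; apply: ideal_pow_sum => j _; apply: ideal_powMl.
have [jk|kj] := ltnP j k.
  by rewrite (vanish_taylor pF vf jk) ?leq_ord //; apply: ideal_pow_0.
have [s [c [sj ->]]] := Fs j; rewrite big_seq_cond; apply: ideal_pow_sum => a.
rewrite andbT => /sj aj; rewrite -mul_mpolyC; apply: ideal_powMl.
apply: ideal_pow_le kj _; rewrite -aj; apply: ideal_pow_prod => i i0 u.
rewrite PE => /vlineP[x ->] _; rewrite -/(ev _ _) ev_frame_coord linearZ /=.
by rewrite -ev_frame_coord ev_frame_point (negPf i0) mulr0.
Qed.

End Frame.
End Order.

(** * Interpolation *)

Section Interpolation.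
Variables (K : fieldType) (n : nat) (I : finType) (v : I -> 'rV[K]_n.+1) (b : nat).
Local Notation R := {mpoly K[n.+1]}.

(** This is the condition that all [T(Z, L)] are at most [b], with the floor cleared. *)
Definition segre_bounded (m : I -> nat) : Prop :=
  forall L : {vspace 'rV[K]_n.+1}, (1 < \dim L)%N ->
  (\sum_(i | v i \in L) m i <= (\dim L).-1 * b + 1)%N.

Hypothesis v_neq0 : forall i, v i != 0.
Hypothesis v_distinct : forall i j, i != j -> v i \notin <[v j]>%VS.
Hypothesis nullity_le2 : (#|I| <= \dim (\sum_i <[v i]>)%VS + 2)%N.
Hypothesis I_gt1 : (1 < #|I|)%N.

Lemma segre_pair (m : I -> nat) i j : segre_bounded m -> i != j -> (m i + m j <= b.+1)%N.
Proof. by move=> Hm ij; apply: (support_pair v_neq0 v_distinct Hm ij). Qed.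

(** Each monomial of degree [mu] is multiplied by linear forms that vanish on the sets of
    [cover_exists] and not at [p], then divided by the value at [p] of their product with [Z]. The
    factor [Z] stands for the denominator in [interpolation]. *)
Lemma local_correction (m : I -> nat) p mu : segre_bounded m -> m p = mu.+1 ->
    (forall i, (0 < m i)%N -> (m p <= m i)%N) -> (mu <= b)%N ->
  exists2 X : n.+1.-tuple 'rV[K]_n.+1, basis_of fullv X & X`_0 = v p /\
  forall (Z : R) (s : seq 'X_{1..n.+1}) (c : 'X_{1..n.+1} -> K), ev (v p) Z != 0 ->
    (forall a, a \in s -> tail_deg a = mu) ->
  exists2 G : R, G \is b.-homog &
    (forall i, i != p -> vanish (v i) (m i) G) /\
    exists q : {poly R}, germ (v p) (G * Z) =
      (\sum_(a <- s) c a *: tail_mon X a)%:P * 'X^mu + q * 'X^(mu.+1).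
Proof.
move=> Hm mp m_min mub.
have dimV : \dim {:'rV[K]_n.+1} = n.+1 by rewrite dimvf /dim /= mul1n.
have [X Xbasis [X0 HX]] :=
  cover_exists v_neq0 v_distinct nullity_le2 Hm mp m_min dimV.
exists X => //; split=> // Z s c Z0.
have mono a : tail_deg a = mu -> exists2 P : R, P \is (b - mu).-homog &
    ev (v p) P != 0 /\ forall i, i != p -> vanish (v i) (m i) (tail_mon X a * P).
  move=> amu; have [S Sp Si] := HX a amu.
  have /fin_all_exists[l lP] k : exists l, ev (v p) (lin l) != 0 /\
      forall i, i \in S k -> ev (v i) (lin l) = 0.
    have [l [l0 lS]] := separating_form (Sp k); exists l; split=> // i iS.
    by apply: lS; rewrite memvE (sumv_sup i).
  exists (\prod_k lin (l k) ^+ 1).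
    have E : (\sum_(k < b - mu) 1 * 1)%N = (b - mu)%N by rewrite sum1_card card_ord.
    by rewrite -[X in X.-homog]E; apply: dhomog_prod_exp => k _; apply: lin_homog.
  split=> [|i ip].
    rewrite /ev rmorph_prod /=; apply/prodf_neq0 => k _.
    by rewrite rmorphXn /= expf_neq0 // (lP k).1.
  apply: vanish_le (vanishM (vanish_prod (v i) _ _ _)
    (vanish_prod (v i) xpredT (fun k => lin (l k)) (fun=> 1%N))).
  apply: leq_trans (Si i ip) _; rewrite addnC; apply: leq_add.
    by apply/eq_leq/eq_bigl => k; rewrite ev_frame_coord.
  rewrite sum1_card -[leqRHS]cardsE; apply/subset_leq_card/subsetP => k.
  by rewrite inE => iS; rewrite inE; apply/eqP/(lP k).2.
elim: s => [|a s IHs] smu.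
  exists 0; first exact: dhomog0.
  split=> [i _|]; first exact: vanish0.
  exists 0; rewrite mul0r big_nil polyC0 !mul0r addr0; exact: rmorph0.
have [|G Gb [Gv [q Eq]]] := IHs.
  by move=> a' a's; apply: smu; rewrite inE a's orbT.
have amu : tail_deg a = mu by apply: smu; rewrite inE eqxx.
have [P Ph [Pp Pv]] := mono a amu.
pose la := ev (v p) (P * Z).
have la0 : la != 0 by rewrite /la /ev rmorphM mulf_neq0.
exists ((c a / la) *: (tail_mon X a * P) + G).
  apply: dhomogD => //; apply: dhomogZ; rewrite -(subnKC mub) -{1}amu.
  apply: dhomogM => //.
  have -> : tail_deg a = (\sum_(k | k != ord0) 1 * a k)%N.
    by apply: eq_bigr => k _; rewrite mul1n.
  by apply: dhomog_prod_exp => k _; apply: lin_homog.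
split=> [i ip|].
  apply: vanishD; last exact: Gv.
  by rewrite -mul_mpolyC; apply: vanishMl; apply: Pv.
have [q' Eq'] := germ_ev (v p) (P * Z).
exists ((c a / la)%:MP%:P * (tail_mon X a)%:P * q' + q).
rewrite mulrDl germD Eq -scalerAl -(mulrA _ P) germZ germM Eq' -/la -X0.
rewrite germ_tail_mon // amu.
rewrite big_cons polyCD mulrDl.
have -> : (c a *: tail_mon X a)%:P =
    (c a / la)%:MP%:P * (tail_mon X a)%:P * la%:MP%:P.
  by rewrite -!polyCM -mul_mpolyC mulrAC -mpolyCM divfK.
rewrite exprS; move: (_ / _)%:MP%:P la%:MP%:P (tail_mon X a)%:P.
move: (\sum_(_ <- _) _)%:P 'X 'X^mu.
move=> x1 x2 x3 x4 x5 x6; clear; ring.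
Qed.

(** The local datum at [v i] is the fraction [u i / z i ^+ N] of degree [b]. The induction corrects,
    at a point of least positive multiplicity, the leading form of the error left by one order
    less. *)
Theorem interpolation (m : I -> nat) (z u : I -> R) (N : nat) :
    segre_bounded m -> (forall i, z i \is 1.-homog) ->
    (forall i, ev (v i) (z i) != 0) -> (forall i, u i \is (b + N).-homog) ->
  exists2 F : R, F \is b.-homog &
    forall i, vanish (v i) (m i) (F * z i ^+ N - u i).
Proof.
move=> Hm z1 z0 uN; have [k] := ubnP (\sum_i m i)%N.
elim: k m Hm => // k IHk m Hm lek.
have [/existsP[i0 mi0]|] := boolP [exists i, (0 < m i)%N]; last first.
  rewrite negb_exists => /forallP m0; exists 0; first exact: dhomog0.
  by move=> i; have := m0 i; rewrite -eqn0Ngt => /eqP->; apply: vanish_exp0.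
have [p mp0 m_min] := @arg_minnP _ i0 (fun i => (0 < m i)%N) m mi0.
pose mu := (m p).-1; have mp : m p = mu.+1 by rewrite prednK.
pose m' i := if i == p then mu else m i.
have m'm i : (m' i <= m i)%N by rewrite /m'; case: eqP => // ->; rewrite mp.
have [||F' F'b F'v] := IHk m'.
- by move=> L L1; apply: leq_trans (leq_sum _ _) (Hm L L1) => i _; apply: m'm.
- rewrite -ltnS; apply: leq_trans lek; rewrite ltnS.
  rewrite (bigD1 p) //= [X in (_ < X)%N](bigD1 p) //=.
  by rewrite {1}/m' eqxx mp addSn ltnS leq_add2l leq_sum.
have mub : (mu <= b)%N.
  have /card_gt0P[j] : (0 < #|predC1 p|)%N.
    by rewrite cardC1; case: #|I| I_gt1 => [|[]].
  rewrite !inE eq_sym => pj; have := segre_pair Hm pj; rewrite mp; lia.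
pose h := u p - F' * z p ^+ N.
have hb : h \is (b + N).-homog.
  apply: dhomogD => //; rewrite dhomogN; apply: dhomogM => //.
  by rewrite -[X in X.-homog]mul1n; apply: dhomogMn.
have hv : vanish (v p) mu h.
  by have := vanishN (F'v p); rewrite /m' eqxx opprB.
have [X Xbasis [X0 corr]] := local_correction Hm mp m_min mub.
have [T [hE TX Ts]] := taylor Xbasis hb.
have [s [c [smu Tmu]]] := Ts mu.
have [|G Gb [Gv [q Gq]]] := corr (z p ^+ N) s c _ smu.
  by rewrite /ev rmorphXn expf_neq0 //; apply: z0.
exists (F' + G); first exact: dhomogD.
move=> i; rewrite mulrDl addrAC; have [->|ip] := eqVneq i p; last first.
  apply: vanishD; first by have := F'v i; rewrite /m' (negPf ip).
  by rewrite mulrC; apply/vanishMl/Gv.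
have -> : F' * z p ^+ N - u p + G * z p ^+ N = G * z p ^+ N - h by rewrite /h; ring.
have muN : (mu < (b + N).+1)%N by lia.
(* In the error [h], Taylor terms below [mu] are 0 and those above have order at least [mu + 1]; the
   term of degree [mu] is matched by [G]. *)
rewrite mp hE (bigD1 (Ordinal muN)) //= opprD addrA; apply: vanishD; last first.
  apply/vanishN/vanish_sum => j jmu; apply: vanishMl.
  have [ltj|] := ltnP j mu.
    rewrite hE in hv; rewrite -X0 in hv.
    by rewrite (vanish_taylor Xbasis TX hv ltj) ?leq_ord //; apply: vanish0.
  rewrite leq_eqVlt => /predU1P[jE|ltj].
    by rewrite -val_eqE /= jE eqxx in jmu.
  by apply: vanish_le ltj _; exists (T j)%:P; rewrite -X0 TX.
have [r Er] := germ_ev (v p) (frame_coord X ord0 ^+ (b + N - mu)).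
exists (q - r * (T mu)%:P).
rewrite /germ rmorphB /= -/(germ _ _) -/(germ (v p) _) Gq -Tmu germM Er.
rewrite -[in germ _ (T mu)]X0 TX.
have -> : ev (v p) (frame_coord X ord0 ^+ (b + N - mu)) = 1.
  by rewrite /ev rmorphXn /= -/(ev _ _) -X0 ev_frame_point // eqxx expr1n.
rewrite mpolyC1 exprS; move: (T mu)%:P 'X 'X^mu; clear=> x1 x2 x3; ring.
Qed.

End Interpolation.

(** * First cohomology of O(d) *)

Section Cocycle.
Variables (K : fieldType) (n : nat).
Local Notation R := {mpoly K[n.+1]}.
Implicit Types (f g r : R) (i j k : 'I_n.+1) (N : nat).

Lemma msuppMXn g i N (a : 'X_{1..n.+1}) : (g * 'X_i ^+ N)@_a != 0 ->
  exists2 c, g@_c != 0 & a = (c + U_(i) *+ N)%MM.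
Proof.
rewrite mpolyXn -mcoeff_msupp (perm_mem (msuppMX _ _)) => /mapP[c cg ->].
by exists c; rewrite ?mcoeff_msupp // in cg *; rewrite addmC.
Qed.

Lemma mcoeffMXn g i N (a : 'X_{1..n.+1}) :
  (g * 'X_i ^+ N)@_(a + U_(i) *+ N) = g@_a.
Proof. by rewrite mpolyXn addmC mcoeffMX. Qed.

Lemma mulmn_var i N k : ((U_(i) *+ N)%MM : 'X_{1..n.+1}) k = ((i == k) * N)%N.
Proof. by rewrite mulmnE mnm1E. Qed.

Lemma dvd_varX d f i N : (forall a, f@_a != 0 -> (N <= a i)%N) ->
  f \is (d + N).-homog -> exists2 g, g \is d.-homog & f = g * 'X_i ^+ N.
Proof.
move=> Ha fd; have lea a : a \in msupp f -> (U_(i) *+ N <= a)%MM.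
  rewrite mcoeff_msupp => /Ha le; apply/mnm_lepP => k; rewrite mulmn_var.
  by case: eqP => [<-|]; rewrite ?mul1n.
exists (\sum_(a <- msupp f) f@_a *: 'X_[a - U_(i) *+ N]).
  rewrite big_seq; apply: dhomog_sum => a af; apply: dhomogZ; rewrite dhomogX /=.
  rewrite -(eqn_add2r N) -(dhomog_mf fd af) /= -[in X in _ == X](submK (lea a af)).
  by rewrite mdegD mdegMn mdeg1 mul1n.
rewrite mulr_suml [LHS]mpolyE !big_seq; apply: eq_bigr => a af.
by rewrite -scalerAl mpolyXn -mpolyXD submK // lea.
Qed.

Lemma split_varX d f i N : f \is (d + N).-homog -> exists w r,
  [/\ w \is d.-homog, r \is (d + N).-homog, f = w * 'X_i ^+ N + r
    & forall a, r@_a != 0 -> (a i < N)%N].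
Proof.
move=> fd; pose r := \sum_(a <- msupp f | (a i < N)%N) f@_a *: 'X_[a].
have rE a : r@_a = if (a i < N)%N then f@_a else 0.
  rewrite raddf_sum /=.
  under eq_bigr => c _ do rewrite mcoeffZ mcoeffX.
  have [af|af] := boolP (a \in msupp f); last first.
    rewrite big_seq_cond big1 => [|c /andP[cf _]].
      by rewrite (eqP (_ : f@_a == 0)) ?if_same // mcoeff_eq0.
    by case: eqP => [E|_]; [rewrite -E cf in af | rewrite mulr0].
  rewrite big_mkcond (bigD1_seq a) //= eqxx mulr1 big1 ?addr0 // => c ca.
  by rewrite (negPf ca) mulr0 if_same.
have rd : r \is (d + N).-homog.
  rewrite /r big_seq_cond; apply: dhomog_sum => a /andP[af _].
  by apply: dhomogZ; rewrite dhomogX; apply/eqP/(dhomog_mf fd af).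
have [||w wd wE] := @dvd_varX d (f - r) i N.
- move=> a; rewrite mcoeffB rE; case: ltnP => //.
  by rewrite subrr eqxx.
- by apply: dhomogD => //; rewrite dhomogN.
exists w, r; split=> // [|a]; first by rewrite -wE subrK.
by rewrite rE; case: ltnP; rewrite ?eqxx.
Qed.

(** This is [H^1(O(d)) = 0] with cleared denominators: [f i j] stands for the section
    [f i j / (x_i x_j)^N]. *)
Theorem cocycle_coboundary d N (f : 'I_n.+1 -> 'I_n.+1 -> R) :
    (0 < n)%N -> (forall i j, f i j \is (d + N + N).-homog) ->
    (forall i j k, f j k * 'X_i ^+ N - f i k * 'X_j ^+ N + f i j * 'X_k ^+ N = 0) ->
  exists2 U : 'I_n.+1 -> R, forall i, U i \is (d + N).-homog &
    forall i j, f i j = U j * 'X_i ^+ N - U i * 'X_j ^+ N.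
Proof.
move=> n0 fd fc.
have X0 i : 'X_i ^+ N != 0 :> R.
  by rewrite expf_neq0 // -msupp_eq0 msuppX.
(* Modulo x_0^N the f 0 j are proportional to the x_j^N. *)
have /fin_all_exists[w /fin_all_exists[r wr]] j : exists w r,
    [/\ w \is (d + N).-homog, r \is (d + N + N).-homog,
        f ord0 j = w * 'X_ord0 ^+ N + r
      & forall a, r@_a != 0 -> (a ord0 < N)%N].
  exact: split_varX (fd ord0 j).
have f00 : f ord0 ord0 = 0.
  have /eqP := fc ord0 ord0 ord0; rewrite subrr add0r mulf_eq0 (negPf (X0 _)) orbF.
  by move/eqP.
have r_cross j k : j != ord0 -> k != ord0 -> r k * 'X_j ^+ N = r j * 'X_k ^+ N.
  (* The difference has degree less than [N] in [x_0], while the cocycle condition makes it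
     divisible by [x_0^N]. *)
  move=> j0 k0; apply/eqP; rewrite -subr_eq0; apply/eqP/mpolyP => a; rewrite mcoeff0.
  apply/eqP; apply: contraT => a0.
  have small : (a ord0 < N)%N.
    have : ((r k * 'X_j ^+ N)@_a != 0) || ((r j * 'X_k ^+ N)@_a != 0).
      rewrite -negb_and; apply: contra a0 => /andP[/eqP E /eqP E'].
      by rewrite mcoeffB E E' subr0.
    case/orP => /msuppMXn[c]; case: (wr k) (wr j) => _ _ _ rk [_ _ _ rj].
      by move/rk => + ->; rewrite mnmDE mulmn_var (negPf j0) mul0n addn0.
    by move/rj => + ->; rewrite mnmDE mulmn_var (negPf k0) mul0n addn0.
  have E : r k * 'X_j ^+ N - r j * 'X_k ^+ N =
      (f j k - w k * 'X_j ^+ N + w j * 'X_k ^+ N) * 'X_ord0 ^+ N.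
    have [_ _ Ek _] := wr k; have [_ _ Ej _] := wr j; have := fc ord0 j k.
    rewrite Ek Ej => /eqP; rewrite -addrA addr_eq0 => /eqP H.
    by rewrite !mulrDl !mulNr H; ring.
  move: a0; rewrite E => /msuppMXn[c _ aE]; move: small.
  by rewrite aE mnmDE mulmn_var eqxx mul1n ltnNge leq_addl.
pose M : 'I_n.+1 := ord_max.
have M0 : M != ord0 by rewrite -val_eqE /= -lt0n.
have [u ud uE] : exists2 u, u \is (d + N).-homog & r M = u * 'X_M ^+ N.
  have [_ rd _ rs] := wr M; apply: dvd_varX => // a a0.
  (* A third variable gives the divisibility by [x_M^N] through [r_cross]. With two variables it
     follows from the total degree [d + 2N] and the exponent of [x_0] being below [N]. *)
  have [/existsP[k /andP[k0 kM]]|] := boolP [exists k, (k != ord0) && (k != M)].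
    have : (r M * 'X_k ^+ N)@_(a + U_(k) *+ N) != 0 by rewrite mcoeffMXn.
    rewrite r_cross // => /msuppMXn[c _ /(congr1 (fun a : 'X_{1..n.+1} => a M))].
    rewrite !mnmDE !mulmn_var (negPf kM) eqxx mul1n mul0n addn0 => ->.
    exact: leq_addl.
  rewrite negb_exists => /forallP only.
  have := dhomog_mf rd; move/(_ a); rewrite mcoeff_msupp => /(_ a0) /=.
  rewrite mdegE (bigD1 ord0) //= (bigD1 M) //= big1 => [|k].
    by have := rs a a0; rewrite addn0; lia.
  by move=> /andP[k0 kM]; have := only k; rewrite k0 kM.
have rE j : j != ord0 -> r j = u * 'X_j ^+ N.
  move=> j0; apply: (mulIf (X0 M)); rewrite r_cross // uE; ring.
pose U j := if j == ord0 then - u else w j.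
exists U.
  by move=> j; rewrite /U; case: eqP => _; [rewrite dhomogN | case: (wr j)].
have f0 k : f ord0 k = U k * 'X_ord0 ^+ N - U ord0 * 'X_k ^+ N.
  have [->|k0] := eqVneq k ord0; first by rewrite f00 subrr.
  rewrite /U eqxx (negPf k0) mulNr opprK -rE //.
  by have [_ _ -> _] := wr k.
move=> j k; apply: (mulIf (X0 ord0)); have := fc ord0 j k.
move/eqP; rewrite addr_eq0 subr_eq => /eqP->; rewrite !f0; ring.
Qed.

End Cocycle.

(** * Regularity of fat points *)

(** Excluded middle replaces a decision procedure, as vanishing of [h^1] is a mere proposition. *)
Lemma least_nat (P : nat -> Prop) k : P k ->
  exists2 l, P l & forall j, P j -> (l <= j)%N.
Proof.
move=> Pk; apply: NNPP => noleast; suff: forall l j, (j < l)%N -> ~ P j.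
  by move/(_ k.+1 k (ltnSn k)).
elim=> // l IHl j; rewrite ltnS => jl Pj; apply: noleast; exists j => // i Pi.
by rewrite leqNgt; apply/negP => ij; case: (IHl i (leq_trans ij jl) Pi).
Qed.

Lemma greatest_int (S : int -> Prop) t (B : int) :
    S t -> (forall s, S s -> s <= B) ->
  exists M, is_max_of S M.
Proof.
move=> St SB;
have [|l [M SM ->] lmin] :=
    @least_nat (fun k => exists2 s, S s & k = `|B - s|%N) `|B - t|%N.
  by exists t.
exists M; split=> // s Ss.
have := lmin _ (ex_intro2 _ _ s Ss erefl); have := SB s Ss; have := SB M SM; lia.
Qed.

Lemma frame_exists (K : fieldType) (n : nat) (v : 'rV[K]_n.+1) : v != 0 ->
  exists2 X : n.+1.-tuple 'rV[K]_n.+1, basis_of fullv X & X`_0 = v.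
Proof.
move=> v0; have dimV : \dim {:'rV[K]_n.+1} = n.+1 by rewrite dimvf /dim /= mul1n.
have [||X Xb [X0 _]] := @extend_basis K _ bool (fun=> v) true (fun=> v0) set0 n dimV.
- by rewrite inE.
- by rewrite /prank /pspan big_set0 addv0 dim_vline v0 cards0.
by exists X.
Qed.

Lemma frac_pad (F : fieldType) (a x y : F) (k N : nat) : (k <= N)%N ->
  x != 0 -> y != 0 -> a / (x * y) ^+ k = (x * y) ^+ (N - k) * a / (x ^+ N * y ^+ N).
Proof.
move=> kN x0 y0; rewrite -exprMn -{2}(subnK kN) exprD.
by rewrite -mulf_div divff ?mul1r // expf_neq0 // mulf_neq0.
Qed.

Lemma frac_cocycle (F : fieldType) (a b c x y z : F) : x != 0 -> y != 0 -> z != 0 ->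
  a / (y * z) - b / (x * z) + c / (x * y) = 0 -> a * x - b * y + c * z = 0.
Proof.
move=> x0 y0 z0 H.
have -> : a * x - b * y + c * z =
    (a / (y * z) - b / (x * z) + c / (x * y)) * (x * y * z).
  by field; rewrite x0 y0 z0.
by rewrite H mul0r.
Qed.

Lemma frac_coboundary (F : fieldType) (a b c x y : F) : x != 0 -> y != 0 ->
  (a * x - b * y) / (x * y) = (a - c * y) / y - (b - c * x) / x.
Proof. by move=> x0 y0; field; rewrite x0 y0. Qed.

Section FatPoints.
Variables (K : fieldType) (n s : nat).
Variables (p : 'I_s -> proj_point K n) (m : 'I_s -> nat).
Local Notation R := {mpoly K[n.+1]}.

Definition rep (i : 'I_s) : 'rV[K]_n.+1 := vpick (val (p i)).

Lemma rep_neq0 i : rep i != 0.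
Proof. by rewrite vpick0 -dimv_eq0 (eqP (valP (p i))). Qed.

Lemma rep_span i : val (p i) = <[rep i]>%VS.
Proof.
apply/esym/eqP; rewrite eqEdim -memvE memv_pick dim_vline rep_neq0.
by rewrite (eqP (valP (p i))).
Qed.

Lemma rep_distinct : injective p -> forall i j, i != j -> rep i \notin <[rep j]>%VS.
Proof.
move=> p_inj i j; apply: contra; rewrite memvE => le; apply/eqP/p_inj/val_inj.
by apply/eqP; rewrite !rep_span eqEdim le !dim_vline !rep_neq0.
Qed.

Lemma lies_on_rep i L : lies_on (p i) L = (rep i \in L).
Proof. by rewrite /lies_on rep_span memvE. Qed.

Lemma fat_idealMl (c f : R) : fat_ideal p m f -> fat_ideal p m (c * f).
Proof. by move=> If i; apply: ideal_powMl. Qed.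

Lemma fat_ideal_vanish f i : fat_ideal p m f -> vanish (rep i) (m i) f.
Proof.
move=> If; apply: (@ideal_pow_vanish _ _ (p i)) => //; last exact: rep_neq0.
exact: memv_pick.
Qed.

Lemma vanish_fat_ideal d f : f \is d.-homog ->
  (forall i, vanish (rep i) (m i) f) -> fat_ideal p m f.
Proof.
move=> fd fv i; have [X Xb X0] := frame_exists (rep_neq0 i).
by apply: (vanish_ideal_pow Xb _ fd); rewrite X0 //; apply: rep_span.
Qed.

Lemma cocycle_common_denominator d g : cech_cocycle1 (fat_ideal p m) d g ->
  exists N (f : 'I_n.+1 -> 'I_n.+1 -> R),
  [/\ forall i j, fat_ideal p m (f i j),
      forall i j, f i j \is (d + N + N).-homog
    & forall i j, g i j = tofrac (f i j) / (tofrac 'X_i ^+ N * tofrac 'X_j ^+ N)].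
Proof.
case=> gs _.
have /fin_all_exists[k kP] (x : 'I_n.+1 * 'I_n.+1) : exists k, exists f,
    [/\ fat_ideal p m f, f \is (d + k * mdeg (U_(x.1) + U_(x.2))%MM)%N.-homog
      & g x.1 x.2 = tofrac f / tofrac 'X_[U_(x.1) + U_(x.2)] ^+ k].
  exact: gs.
have {kP}/fin_all_exists[f fP] := kP.
pose N := (\sum_x k x)%N.
have kN x : (k x <= N)%N by rewrite /N (bigD1 x) //= leq_addr.
exists N, (fun i j => ('X_i * 'X_j) ^+ (N - k (i, j)) * f (i, j)); split=> i j.
- by apply: fat_idealMl; case: (fP (i, j)).
- have [_ fh _] := fP (i, j).
  have -> : (d + N + N =
      2 * (N - k (i, j)) + (d + k (i, j) * mdeg (U_(i) + U_(j))%MM))%N.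
    by have := kN (i, j); rewrite mdegD !mdeg1; lia.
  apply: dhomogM => //; apply: dhomogMn; rewrite -[2%N]/(1 + 1)%N.
  by apply: dhomogM; rewrite dhomogX /= mdeg1.
have [_ _ /= ->] := fP (i, j).
have X0 l : tofrac ('X_l : R) != 0 by rewrite tofrac_eq0 -msupp_eq0 msuppX.
rewrite mpolyXD !rmorphM !rmorphXn /= !rmorphM /=.
exact: frac_pad.
Qed.

(** The cocycle bounds in [O(d)], by sections [U i / x_i^N]. Subtracting one global form [F] from
    all of them keeps the coboundary; interpolation provides an [F] that moves them into the ideal
    sheaf. *)
Lemma fat_h1_vanishes d : (0 < n)%N -> injective p ->
    (s <= \dim (\sum_i <[rep i]>)%VS + 2)%N -> (1 < s)%N ->
    segre_bounded rep d m -> h1_vanishes (fat_ideal p m) d.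
Proof.
move=> n0 p_inj null s1 Hm g gP.
have [N [f [fI fh gE]]] := cocycle_common_denominator gP.
have X0 l : tofrac ('X_l : R) != 0 by rewrite tofrac_eq0 -msupp_eq0 msuppX.
have [i j k|U Uh fE] := @cocycle_coboundary K n d N f n0 fh.
  have [_ /(_ i j k)] := gP; rewrite !gE => H.
  apply/eqP; rewrite -tofrac_eq0; apply/eqP.
  rewrite rmorphD rmorphB !rmorphM !rmorphXn /=.
  by apply: frac_cocycle H; rewrite expf_neq0.
have /fin_all_exists[e e0] i : exists e, rep i ord0 e != 0 by apply/rV0Pn/rep_neq0.
have cI : (#|'I_s| <= \dim (\sum_i <[rep i]>)%VS + 2)%N by rewrite card_ord.
have I1 : (1 < #|'I_s|)%N by rewrite card_ord.
have [|||F Fd Fv] := interpolation rep_neq0 (rep_distinct p_inj) cI I1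
    (z := fun i => 'X_(e i)) (u := fun i => U (e i)) (N := N) Hm.
- by move=> i; rewrite dhomogX /= mdeg1.
- by move=> i; rewrite /ev mevalXU.
- by move=> i; apply: Uh.
(* The condition at [p l] was imposed in the single chart [e l]. It passes to the chart [i] because
   [f (e l) i] lies in the fat ideal and [x_(e l)] is nonzero at [p l]. *)
have Fall l i : vanish (rep l) (m l) (F * 'X_i ^+ N - U i).
  apply: (@vanish_cancel _ _ _ _ _ ('X_(e l) ^+ N)).
    by rewrite /ev rmorphXn /= mevalXU expf_neq0.
  have -> : (F * 'X_i ^+ N - U i) * 'X_(e l) ^+ N =
     'X_i ^+ N * (F * 'X_(e l) ^+ N - U (e l)) - f (e l) i by rewrite fE; ring.
  by apply: vanishD; [apply: vanishMl | apply/vanishN/fat_ideal_vanish].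
have hom i : F * 'X_i ^+ N - U i \is (d + N).-homog.
  apply: dhomogD; last by rewrite dhomogN.
  apply: dhomogM => //; rewrite -[X in X.-homog]mul1n; apply: dhomogMn.
  by rewrite dhomogX /= mdeg1.
exists (fun i => tofrac (U i - F * 'X_i ^+ N) / tofrac 'X_i ^+ N) => [i|i j].
  exists N, (U i - F * 'X_i ^+ N); rewrite mdeg1 muln1 -opprB; split=> //.
    apply: (vanish_fat_ideal (d := d + N)) => [|l]; first by rewrite dhomogN.
    exact: vanishN.
  by rewrite dhomogN.
rewrite gE fE !rmorphB !rmorphM !rmorphXn /=.
by apply: frac_coboundary; rewrite expf_neq0.
Qed.

Lemma segre_T_le (L : {vspace 'rV[K]_n.+1}) (M : int) : (0 < proj_dim L)%N ->
  (segre_T p m L <= M) = ((weight p m L)%:Z <= (proj_dim L)%:Z * M + 1).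
Proof.
rewrite /segre_T; move: (weight _ _ _) (proj_dim _) => w r r0.
have r0' : (0 < r%:Z) by lia.
have := divz_eq (w%:Z + r%:Z - 2) r%:Z; have := ltz_pmod (w%:Z + r%:Z - 2) r0'.
have := modz_ge0 (w%:Z + r%:Z - 2) (lt0r_neq0 r0').
move: (_ %/ _)%Z (_ %% _)%Z => q t t0 tr E; apply/idP/idP => H; nia.
Qed.

Lemma segre_bounded_of_max (M : int) : 0 <= M ->
    (forall L : {vspace 'rV[K]_n.+1},
       (1 <= proj_dim L <= n)%N -> segre_T p m L <= M) ->
  segre_bounded rep `|M|%N m.
Proof.
move=> M0 HM L L1; have rL : (0 < proj_dim L)%N.
  by rewrite /proj_dim; case: (\dim L) L1 => [|[]].
have rn : (proj_dim L <= n)%N.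
  have := dimvS (subvf L); rewrite dimvf /dim /= mul1n /proj_dim.
  by case: (\dim L).
have := HM L; rewrite rL rn => /(_ isT); rewrite segre_T_le //.
have -> : weight p m L = (\sum_(i | rep i \in L) m i)%N.
  by apply: eq_bigl => i; rewrite lies_on_rep.
by rewrite -/(proj_dim L); lia.
Qed.

(** All [T(Z, L)] are bounded by the sum of the [m i]. The line through two of the points has [T]
    equal to its weight minus 1, so the maximum is a positive degree. *)
Lemma segre_max_exists : (0 < n)%N -> injective p -> (1 < s)%N ->
    (forall i, (0 < m i)%N) ->
  exists M : int, 1 <= M /\ is_max_of
    (fun t : int => exists L : {vspace 'rV[K]_n.+1},
       (1 <= proj_dim L <= n)%N /\ t = segre_T p m L) M.
Proof.
move=> n0 p_inj s1 m0; pose S t := exists L : {vspace 'rV[K]_n.+1},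
  (1 <= proj_dim L <= n)%N /\ t = segre_T p m L.
pose i0 : 'I_s := Ordinal (ltnW s1); pose i1 : 'I_s := Ordinal s1.
pose L := (<[rep i0]> + <[rep i1]>)%VS.
have dL : \dim L = 2 by rewrite dim_two_lines ?rep_neq0 ?rep_distinct.
have SL : S (segre_T p m L) by exists L; rewrite /proj_dim dL.
have [t [L' [/andP[L1 _] ->]]|M [[L' [L1 ->]] Mmax]] :=
    greatest_int (B := (\sum_i m i)%N%:Z) SL.
  rewrite segre_T_le //; have : (weight p m L' <= \sum_i m i)%N.
    by rewrite [leqRHS](bigID (fun i => lies_on (p i) L')) leq_addr.
  by move: (weight _ _ _) (\sum_i _)%N (proj_dim _) L1 => w W r r0; nia.
exists (segre_T p m L'); split; last first.
  by split=> //; exists L'.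
apply: le_trans (Mmax _ SL); rewrite /segre_T /proj_dim dL divz1.
have : (2 <= weight p m L)%N.
  rewrite /weight (bigD1 i0) ?lies_on_rep ?memvE ?addvSl //=.
  rewrite (bigD1 i1) ?lies_on_rep ?memvE ?addvSr //=.
  by have := m0 i0; have := m0 i1; lia.
lia.
Qed.

End FatPoints.

Theorem theorem2p1 (K : closedFieldType) (n : nat) (hn : (1 <= n)%N)
    (p : 'I_(n + 3) -> proj_point K n) (p_distinct : injective p)
    (p_span : spans_space p)
    (m : 'I_(n + 3) -> nat) (m_pos : forall i, (0 < m i)%N) :
  exists (r : nat) (M : int),
    [/\ is_reg_index (fat_ideal p m) r,
        is_max_of
          (fun t : int => exists L : {vspace 'rV[K]_n.+1},
             (1 <= proj_dim L <= n)%N /\ t = segre_T p m L) M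
      & r%:Z <= M].
Proof.
have s1 : (1 < n + 3)%N by rewrite addn3.
have [M [M1 Mmax]] := segre_max_exists hn p_distinct s1 m_pos.
pose P d := (0 < d)%N /\ h1_vanishes (fat_ideal p m) d.
have PM : P `|M|%N.
  split; first by lia.
  apply: fat_h1_vanishes => //.
    (* The [n + 3] points span a vector space of dimension [n + 1], hence nullity 2. *)
    have -> : (\sum_i <[rep p i]>)%VS = fullv.
      by rewrite -p_span; apply: eq_bigr => i _; rewrite -rep_span.
    by rewrite dimvf /dim /= mul1n addn2 addn3.
  apply: segre_bounded_of_max => [|L HL]; first exact: le_trans M1.
  by apply: Mmax.2; exists L.
have [r [r0 rh] rmin] := least_nat PM.
exists r, M; split=> //.
  by split=> // e e0 eh; apply: rmin.
by have := rmin _ PM; lia.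
Qed.
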